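(* Let $1\le b\le d$ be fixed integers. Let $(\phi_i)_{i\in\mathbb{N}_0}$ be an orthonormal basis of $L_2([0,1])$ with $\phi_0(u)=1$ for all $u\in[0,1]$, and let $(\lambda(i))_{i\in\mathbb{N}_0}$ be nonnegative numbers satisfying $$\lambda(i)\sim\mu\, i^{-r}(\ln i)^q,\qquad i\to\infty,$$ for some $\mu>0$, $r>1/2$ and $q<-r$. Let $X_{d,b}(t)$, $t\in[0,1]^d$, be the additive random field of order $b$ $$X_{d,b}(t)=\sum_{\mathcal{A}\in\mathcal{D}_b}\ \sum_{k\in\mathbb{N}_0^{\mathcal{A}}}\Big(\prod_{a\in\mathcal{A}}\lambda(k_a)\prod_{a\in\mathcal{A}}\phi_{k_a}(t_a)\Big)\xi_k^{\mathcal{A}},$$ where $(\xi_k^{\mathcal{A}},\ \mathcal{A}\in\mathcal{D}_b,\ k\in\mathbb{N}_0^{\mathcal{A}})$ are non-correlated random variables with mean zero and unit variance. Then there exist a constant $C=C(X_{d,b})$ and a sequence of linear approximation algorithms $(A_n)_{n\ge2}$, where $A_n$ uses $n$ point values, such that for each $n\ge 2$ $$\mathbb{E}\|X_{d,b}-A_nX_{d,b}\|_2^2\le C\, n^{1-2r}(\ln n)^{2(q+r)-1}.$$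
   Context: $\mathbb{N}_0=\{0,1,2,\dots\}$; $\mathcal{D}_b$ is the collection of all subsets $\mathcal{A}\subset\{1,\dots,d\}$ with exactly $b$ elements; $\mathbb{N}_0^{\mathcal{A}}$ is the set of multi-indices $k=(k_a)_{a\in\mathcal{A}}$ with entries in $\mathbb{N}_0$. $\|\cdot\|_2$ is the norm of $L_2([0,1]^d)$ with Lebesgue measure. The series defining $X_{d,b}$ converges in mean square; $X_{d,b}$ is jointly measurable with sample paths considered as elements of $L_2([0,1]^d)$. A linear approximation algorithm using $n$ point values is a map $Af=\sum_{l=1}^nf(\tau_l)\psi_l$ with fixed non-random points $\tau_l\in[0,1]^d$ and fixed non-random functions $\psi_l\in L_2([0,1]^d)$; these may depend on the distribution of $X_{d,b}$ but not on its realization. The constant $C$ does not depend on $n$. *)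

(* Defs.v *)
From HB Require Import structures.
From mathcomp Require Import all_boot all_order all_algebra finmap.
From mathcomp Require Import all_classical all_reals all_analysis.
From mathcomp Require summability.

Set Implicit Arguments.
Unset Strict Implicit.
Unset Printing Implicit Defensive.

Import Order.TTheory GRing.Theory Num.Theory.
Import numFieldNormedType.Exports.

Local Open Scope classical_set_scope.
Local Open Scope ring_scope.
Local Open Scope ereal_scope.

Section tuple_measure.
Context {R : realType} d {T : measurableType d}.

Definition cons_pair n (p : T * n.-tuple T) : n.+1.-tuple T :=
  [tuple of p.1 :: p.2].

Lemma measurable_cons_pair n : measurable_fun setT (@cons_pair n).
Proof. exact: measurable_cons. Qed.

Variable mu : {sigma_finite_measure set T -> \bar R}.

Section step.
Context n (m : {sigma_finite_measure set (n.-tuple T) -> \bar R}).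

Definition tuple_measureS : set (n.+1.-tuple T) -> \bar R :=
  pushforward (mu \x m) (cons_pair (n := n)).

Let tuple_measureS0 : tuple_measureS set0 = 0.
Proof. by rewrite /tuple_measureS /pushforward preimage_set0 measure0. Qed.

Let tuple_measureS_ge0 A : 0 <= tuple_measureS A.
Proof. by rewrite /tuple_measureS /pushforward measure_ge0. Qed.

Let tuple_measureS_sigma_additive : semi_sigma_additive tuple_measureS.
Proof.
exact: (@measure_semi_sigma_additive _ _ _
  (measure_function_pushforward__canonical__measure_function_Measure
     (mu \x m) (@measurable_cons_pair n))).
Qed.

HB.instance Definition _ := isMeasure.Build _ _ _ tuple_measureS
  tuple_measureS0 tuple_measureS_ge0 tuple_measureS_sigma_additive.

Lemma tuple_measureS_sigma_finite : sigma_finite setT tuple_measureS.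
Proof.
have /sigma_finiteP[F [FT ndF Foo]] := sigma_finiteT mu.
have /sigma_finiteP[G [GT ndG Goo]] := sigma_finiteT m.
pose g (t : n.+1.-tuple T) := (thead t, [tuple of behead t]).
have gK : cancel (@cons_pair n) g.
  by move=> [x s]; congr pair; apply/val_inj.
have mg : measurable_fun setT g.
  apply/measurable_fun_pairP; split.
    exact: measurable_tnth.
  exact: measurable_behead.
exists (fun k => g @^-1` (F k `*` G k)).
  apply/esym; rewrite -subTset => t _.
  have : [set: T] (g t).1 by []. have : [set: n.-tuple T] (g t).2 by [].
  rewrite FT GT => -[i _ Gi] [j _ Fj]; exists (maxn i j) => //; split.
    by move: Fj; exact/subsetPset/ndF/leq_maxr.
  by move: Gi; exact/subsetPset/ndG/leq_maxl.
move=> k; have [mF Fk] := Foo k; have [mG Gk] := Goo k; split.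
  by rewrite -[_ @^-1` _]setTI; apply: mg => //; exact: measurableX.
rewrite /tuple_measureS /pushforward (_ : _ @^-1` _ = F k `*` G k).
  by rewrite product_measure1E// lte_mul_pinfty// ge0_fin_numE.
rewrite -comp_preimage (_ : g \o _ = id)//.
by apply/funext => x; exact: gK.
Qed.

HB.instance Definition _ :=
  Measure_isSigmaFinite.Build _ _ _ tuple_measureS tuple_measureS_sigma_finite.

End step.

Fixpoint tuple_measure n : {sigma_finite_measure set (n.-tuple T) -> \bar R} :=
  match n with
  | 0 => \d_ ([tuple] : 0.-tuple T)
  | n'.+1 => tuple_measureS (tuple_measure n')
  end.

End tuple_measure.

Section lebesgue_tuple.
Context {R : realType}.

(* [lebesgue_measure] lives on [measurableTypeR R] (Borel sets of [R]), hence
   the type of the points of R^n below. *)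
Definition lebesgue_tuple n :
    {sigma_finite_measure set (n.-tuple (measurableTypeR R)) -> \bar R} :=
  tuple_measure lebesgue_measure n.

Definition unit_cube n : set (n.-tuple (measurableTypeR R)) :=
  [set t | forall a, (0 <= tnth t a :> R)%R /\ (tnth t a <= 1 :> R)%R].

Lemma lebesgue_tuple_box n (A : 'I_n -> set (measurableTypeR R)) :
  (forall i, measurable (A i)) ->
  lebesgue_tuple n [set t | forall i, A i (tnth t i)] =
  \prod_(i < n) lebesgue_measure (A i).
Proof.
rewrite /lebesgue_tuple; elim: n A => [|n IH] A mA /=.
  by rewrite big_ord0 diracE mem_set//= => -[].
rewrite big_ord_recl /tuple_measureS /pushforward -IH//.
rewrite -product_measure1E//; last first.
  rewrite (_ : [set _ | _] = \bigcap_(i in [set: 'I_n])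
      ((fun t : n.-tuple (measurableTypeR R) => tnth t i) @^-1` A (lift ord0 i))).
    apply: fin_bigcap_measurable => // i _; rewrite -[_ @^-1` _]setTI.
    exact: measurable_tnth.
  by apply/seteqP; split=> t /= At i; [move=> _; exact: At|exact: At].
congr (_ _); apply/seteqP; split => -[x s] /=.
  by move=> As; split => [|i]; [exact: (As ord0)|have := As (lift ord0 i); rewrite tnthS].
move=> [Ax As] i; case: (unliftP ord0 i) => [j ->|->]//.
by rewrite tnthS.
Qed.

End lebesgue_tuple.

Section L2.
Context {R : realType} d {T : measurableType d}.
Variables (mu : {measure set T -> \bar R}) (D : set T).

Definition sqnorm2 (f : T -> R) : \bar R := \int[mu]_(x in D) (f x ^+ 2)%:E.

Definition inL2 (f : T -> R) : Prop :=
  measurable_fun D f /\ sqnorm2 f < +oo.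

Definition inner (f g : T -> R) : R := (\int[mu]_(x in D) (f x * g x))%R.

Definition orthonormal_basis (phi : nat -> T -> R) : Prop :=
  [/\ forall i, inL2 (phi i),
      forall i j, inner (phi i) (phi j) = ((i == j)%:R)%R
    & forall f, inL2 f ->
        sqnorm2 (fun x => f x - \sum_(i < n) inner f (phi i) * phi i x)%R
          @[n --> \oo] --> 0].

End L2.

Section additive_field.
Context {R : realType} (d b : nat).

Definition bsubset := {A : {set 'I_d} | #|A| == b}.

Definition multi_index (A : {set 'I_d}) := {ffun {a : 'I_d | a \in A} -> nat}.

Definition field_index := {A : bsubset & multi_index (val A)}.

HB.instance Definition _ := Choice.on field_index.

Definition field_coef (lambda : nat -> R) (phi : nat -> measurableTypeR R -> R)
    (i : field_index) (t : d.-tuple (measurableTypeR R)) : R :=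
  let k := tagged i in
  ((\prod_a lambda (k a)) * (\prod_a phi (k a) (tnth t (val a))))%R.

Definition field_partial_sum (T : Type) (lambda : nat -> R)
    (phi : nat -> measurableTypeR R -> R) (xi : field_index -> T -> R)
    (F : {fset field_index}) (t : d.-tuple (measurableTypeR R)) (w : T) : R :=
  (\sum_(i <- F) field_coef lambda phi i t * xi i w)%R.

(* The index set carries no order: convergence is along the finite sets of
   indices, directed by inclusion. *)
Definition mean_square_series dT (T : measurableType dT) (P : probability T R)
    (lambda : nat -> R) (phi : nat -> measurableTypeR R -> R)
    (xi : field_index -> T -> R) (t : d.-tuple (measurableTypeR R))
    (Y : T -> R) : Prop :=
  'E_P[fun w => ((Y w - field_partial_sum lambda phi xi F t w) ^+ 2)%R]
    @[F --> summability.totally] --> 0.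

End additive_field.

Record sampling_algorithm (R : realType) (d n : nat) := SamplingAlgorithm {
  sample_point : 'I_n -> d.-tuple (measurableTypeR R) ;
  sample_weight : 'I_n -> d.-tuple (measurableTypeR R) -> R ;
  sample_point_cube : forall l, unit_cube (sample_point l) ;
  sample_weight_L2 : forall l,
    inL2 (lebesgue_tuple d) (@unit_cube R d) (sample_weight l) }.

Definition run_algorithm (R : realType) (d n : nat)
    (A : sampling_algorithm R d n) (f : d.-tuple (measurableTypeR R) -> R)
    (t : d.-tuple (measurableTypeR R)) : R :=
  (\sum_(l < n) f (sample_point A l) * sample_weight A l t)%R.

(* Main.v *)
Require Import Defs.
From HB Require Import structures.
From mathcomp Require Import all_boot all_order all_algebra finmap.
From mathcomp Require Import all_classical all_reals all_analysis.
From mathcomp Require Import measurable_realfun.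
From mathcomp Require Import ring lra.

Import Order.TTheory GRing.Theory Num.Theory.
Import numFieldNormedType.Exports.

Local Open Scope classical_set_scope.
Local Open Scope ring_scope.

(** Since [phi 0 = 1], every summand of the field is a random multiple of a
    tensor product [e_k(t) = prod_a phi_(k_a)(t_a)] with [k] a multi-index over
    all [d] coordinates, namely the given multi-index extended by zeros
    ([extend], [field_coefE]).  The [e_k] are orthonormal in the cube, so the
    problem splits into a choice of frequencies and a choice of points.

    Frequencies.  Put [s = - q / r > 1] and
    [weight i = 1 / ((i + 1) (1 + ln (i + 1))^s)]; then [lambda <= C weight^r]
    and the weights are summable.  For [M >= 1] the cross [in_cross s M] keeps
    the [k] having a coordinate [j] with
    [k_j + 1 <= M prod_(a != j) weight (k_a)].  Summability gives at most
    [c M] of them ([card_cross_le]).  Outside the cross the largest coordinate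
    [z] satisfies [ln z >= c ln M], so that its logarithmic factor is at most
    of order [(ln M)^(2 q)] and the squared coefficients sum up to
    [C M^(1 - 2 r) (1 + ln M)^(2 q)] ([sum_outside_cross]): as [s > 1], a
    single large coordinate dominates and the tensor product behaves like the
    univariate problem.

    Points.  Let [S_F] be the part of the field carried by the [m] frequencies
    in the cross, with random coefficient vector [sc], and let [h = X - S_F].
    Starting from zero, update an approximation [a] of [sc] by projecting it
    onto the hyperplane of all coefficient vectors that reproduce the value
    [X(t)] at one further point [t].  With [x = a - sc], such a step changes the
    squared error into
    [|x|^2 - <x, e(t)>^2 / |e(t)|^2 + h(t)^2 / |e(t)|^2]
    ([kaczmarz_identity]).  Averaged over [t] with density [|e(t)|^2 / m], this
    is [(1 - 1/m) |x|^2 + |h|_2^2 / m], by orthonormality; hence some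
    deterministic [t], depending on second moments only, does at least as well
    ([kaczmarz_step]).  After [n] points the mean squared error of the
    coefficients is at most a multiple of the tail plus [(1 - 1/m)^n] times a
    constant ([kaczmarz_coefficients]), and Tonelli's theorem turns this into a
    bound on the error of the algorithm ([kaczmarz_error], [field_algorithm]).

    Balance.  With [M] of order [n / ln n] ([cross_size]) the geometric factor
    decays like [n^(- 2 r)] ([exp_decay]) while the tail is of order
    [(n / ln n)^(1 - 2 r) (ln n)^(2 q)] ([tail_rate]), which is the asserted
    rate. *)

(** * Powers and logarithmic weights *)

Section powers.
Context {R : realType}.
Implicit Types a b p s x y : R.

Lemma powR_le_neg {a b p} : 0 < a -> a <= b -> 0 <= p ->
  b `^ (- p) <= a `^ (- p).
Proof.
move=> a0 ab p0; have b0 := lt_le_trans a0 ab.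
rewrite !powRN lef_pV2 ?posrE ?powR_gt0//.
by apply: ge0_ler_powR => //; rewrite nnegrE ltW.
Qed.

(** The tangent inequality of the convex function [t^(1 - p)]; summed over
    consecutive integers, or consecutive values of [1 + ln i], it replaces the
    integral test. *)
Lemma powR_telescope {p a b} : 0 < a -> a <= b -> 1 < p ->
  (p - 1) * (b - a) * b `^ (- p) <= a `^ (1 - p) - b `^ (1 - p).
Proof.
move=> a0 ab p1; have b0 := lt_le_trans a0 ab.
have bN : b != 0 by rewrite gt_eqF.
have aN : a != 0 by rewrite gt_eqF.
have -> : b `^ (- p) = b `^ (1 - p) / b.
  by rewrite powRD ?bN ?implybT// powRr1 ?ltW// mulrAC divff// mul1r.
have -> : a `^ (1 - p) = b `^ (1 - p) * expR ((p - 1) * (ln b - ln a)).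
  rewrite /powR (negbTE aN) (negbTE bN) -expRD; congr expR; ring.
have h1 : a / b >= 1 + (ln a - ln b).
  rewrite -ln_div ?posrE// -{2}(lnK (_ : a / b \in Num.pos)) ?posrE ?divr_gt0//.
  exact: expR_ge1Dx.
have h2 : (p - 1) * (b - a) / b <= (p - 1) * (ln b - ln a).
  rewrite -mulrA ler_pM2l ?subr_gt0// mulrBl divff//; lra.
have h3 := expR_ge1Dx ((p - 1) * (ln b - ln a)).
have -> : (p - 1) * (b - a) * (b `^ (1 - p) / b) =
   b `^ (1 - p) * ((p - 1) * (b - a) / b) by ring.
rewrite -[X in _ <= _ - X]mulr1 -mulrBr ler_wpM2l ?powR_ge0//; lra.
Qed.

(** Valid for all [y > 0], also below [1], where the bound exceeds the full sum:
    the thresholds met outside a cross can be arbitrarily small. *)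
Lemma sum_powR_tail {p} : 1 < p -> exists2 C, 0 < C &
  forall y, 0 < y -> forall B : nat,
    \sum_(i < B | y < i.+1%:R) i.+1%:R `^ (- p) <= C * y `^ (1 - p).
Proof.
move=> p1; pose c := 2 `^ p / (p - 1).
have c0 : 0 < c by rewrite divr_gt0 ?powR_gt0// subr_gt0.
exists c => // y y0 B.
have pE : 1 - p = - (p - 1) by ring.
suff : \sum_(i < B | y < i.+1%:R) i.+1%:R `^ (- p) +
    c * (Num.max y B.+1%:R) `^ (1 - p) <= c * y `^ (1 - p).
  apply: le_trans; rewrite lerDl mulr_ge0 ?powR_ge0 ?ltW//.
have maxp n : 0 < Num.max y n%:R by rewrite lt_max y0.
elim: B => [|B IH].
  rewrite big_ord0 add0r ler_pM2l// pE powR_le_neg ?le_max ?lexx//; lra.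
apply: le_trans IH; rewrite big_mkcond big_ord_recr/= -big_mkcond/= -addrA lerD2l.
have [yB|yB] := ltP y B.+1%:R; last first.
  rewrite add0r ler_pM2l// pE powR_le_neg//; last by lra.
  by rewrite le_max lexx.
have yB2 : y <= B.+2%:R by rewrite (le_trans (ltW yB))// ler_nat.
rewrite (max_r yB2).
have h := @powR_telescope p B.+1%:R B.+2%:R _ _ p1.
rewrite -lerBrDr -mulrBr.
apply: le_trans (_ : c * ((p - 1) * (B.+2%:R - B.+1%:R) * B.+2%:R `^ (- p)) <= _); last first.
  by rewrite ler_pM2l// h// ?ltr0n// ler_nat.
rewrite -natrB// subSnn mulr1 /c mulrA divfK ?gt_eqF ?subr_gt0//.
have : (2 * B.+1%:R) `^ (- p) <= B.+2%:R `^ (- p).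
  rewrite powR_le_neg//; last by lra.
  by rewrite -natrM ler_nat mul2n -addnn addSnnS leq_addl.
rewrite powRM ?ler0n// powRN -ler_pdivlMl ?invr_gt0 ?powR_gt0// invrK.
exact.
Qed.

(** The shifts by one keep [loglen] at least [1] and give [weight s 0 = 1], so
    that a coordinate equal to [0] does not contribute to products of weights. *)
Definition loglen (i : nat) : R := 1 + ln i.+1%:R.

Lemma loglen_ge1 i : 1 <= loglen i.
Proof. by rewrite lerDl ln_ge0// ler1n. Qed.

Lemma loglen_gt0 i : 0 < loglen i.
Proof. exact: lt_le_trans (loglen_ge1 i). Qed.

Lemma loglen_le i : loglen i <= i.+1%:R.
Proof. 
rewrite /loglen; have := @le_ln1Dx R (i%:R); rewrite nat1r => h.
by rewrite -[leRHS]nat1r lerD2l h// (lt_le_trans (ltrN10 _))// ler0n.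
Qed.

Definition weight s (i : nat) : R := (i.+1%:R * loglen i `^ s)^-1.

Lemma weight_gt0 s i : 0 < weight s i.
Proof. by rewrite invr_gt0 mulr_gt0 ?ltr0n// powR_gt0// loglen_gt0. Qed.

Lemma weight0 s : weight s 0 = 1.
Proof. by rewrite /weight /loglen ln1 addr0 powR1 mulr1 invr1. Qed.

Lemma weight_le s i : 0 <= s -> weight s i <= i.+1%:R^-1.
Proof.
move=> s0; rewrite lef_pV2 ?posrE ?mulr_gt0 ?ltr0n ?powR_gt0 ?loglen_gt0//.
rewrite ler_peMr ?ler0n// -(powRr0 (loglen i)).
by apply: ler_powR => //; exact: loglen_ge1.
Qed.

Lemma weight_le1 s i : 0 <= s -> weight s i <= 1.
Proof.
by move=> s0; rewrite (le_trans (weight_le _ _ s0))// invf_le1 ?ltr0n// ler1n.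
Qed.

(** A crude polynomial lower bound: enough to compare logarithms of the
    coordinates with the logarithm of the size of a cross. *)
Lemma weight_ge s i : 0 <= s -> i.+1%:R `^ (- (1 + s)) <= weight s i.
Proof.
move=> s0; rewrite powRN lef_pV2 ?posrE ?mulr_gt0 ?ltr0n ?powR_gt0 ?loglen_gt0//.
rewrite powRD ?pnatr_eq0 ?implybT// powRr1 ?ler0n// ler_wpM2l ?ler0n//.
by apply: ge0_ler_powR => //; rewrite ?nnegrE ?loglen_le// ltW// loglen_gt0.
Qed.

Lemma sum_weight s : 1 < s -> exists2 W, 1 <= W &
  forall B : nat, \sum_(i < B) weight s i <= W.
Proof.
move=> s1; have s0 : 0 < s - 1 by rewrite subr_gt0.
exists (1 + (s - 1)^-1); first by rewrite lerDl invr_ge0 ltW.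
case=> [|B]; first by rewrite big_ord0 addr_ge0// invr_ge0 ltW.
rewrite big_ord_recl weight0 lerD2l.
suff : \sum_(i < B) weight s i.+1 + (s - 1)^-1 * loglen B `^ (1 - s) <= (s - 1)^-1.
  by apply: le_trans; rewrite lerDl mulr_ge0 ?powR_ge0// invr_ge0 ltW.
elim: B => [|B IH]; first by rewrite big_ord0 add0r /loglen ln1 addr0 powR1 mulr1.
apply: le_trans IH; rewrite big_ord_recr/= -addrA lerD2l -lerBrDr -mulrBr.
rewrite -ler_pdivrMl ?invr_gt0// invrK.
have LB : loglen B.+1 - loglen B >= B.+2%:R^-1.
  have -> : loglen B.+1 - loglen B = - ln (B.+1%:R / B.+2%:R).
    by rewrite /loglen ln_div ?posrE ?ltr0n//; ring.
  rewrite lerNr.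
  have := @le_ln1Dx R (- B.+2%:R^-1) _; rewrite ltrN2 invf_lt1 ?ltr0n// ltr1n.
  move=> /(_ isT) ; congr (ln _ <= _).
  have : 0 < B.+1%:R :> R by rewrite ltr0n.
  rewrite -[B.+2%:R]natr1; move: (B.+1%:R) => x x0.
  by field; rewrite gt_eqF// addr_gt0.
have LBle : loglen B <= loglen B.+1.
  by rewrite -subr_ge0 (le_trans _ LB)// invr_ge0 ler0n.
apply: le_trans (powR_telescope (loglen_gt0 B) LBle s1).
rewrite -mulrA ler_pM2l// /weight invfM -powRN.
by rewrite ler_wpM2r// powR_ge0.
Qed.

End powers.

(** * Hyperbolic crosses *)

Lemma prod_powR {R : realType} (I : finType) (Q : pred I) (f : I -> R) (p : R) :
  (forall i, 0 <= f i) -> \prod_(i | Q i) f i `^ p = (\prod_(i | Q i) f i) `^ p.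
Proof.
move=> f0; suff [] : 0 <= \prod_(i | Q i) f i /\
  \prod_(i | Q i) f i `^ p = (\prod_(i | Q i) f i) `^ p by [].
elim/big_rec2: _ => [|i y z _ [y0 ->]]; first by rewrite powR1.
by rewrite mulr_ge0 ?f0// powRM ?f0.
Qed.

Section crosses.
Context {R : realType} {d : nat}.

Section fiber.
Context {B : nat} (j : 'I_d).
Implicit Types (k : {ffun 'I_d -> 'I_B.+1}) (x : 'I_B.+1).

Definition setcoord k x : {ffun 'I_d -> 'I_B.+1} :=
  [ffun a => if a == j then x else k a].

(** A sum over a box is controlled fibre by fibre along coordinate [j]: if each
    fibre is bounded by [c] times the product of [g] over the other coordinates,
    the remaining sum factorizes.  Both the cardinality of a cross and the tail
    outside of it have this form. *)
Lemma sum_fibers (P : pred {ffun 'I_d -> 'I_B.+1})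
    (f : {ffun 'I_d -> 'I_B.+1} -> R) (g : nat -> R) (c W : R) :
  (forall i, 0 <= g i) -> 0 <= c -> 1 <= W -> \sum_(i < B.+1) g i <= W ->
  (forall k, P k -> 0 <= f k) ->
  (forall k, \sum_(x | P (setcoord k x)) f (setcoord k x)
     <= c * \prod_(a | a != j) g (k a)) ->
  \sum_(k | P k) f k <= c * W ^+ d.
Proof.
move=> g0 c0 W1 gW f0 fib.
rewrite (partition_big (fun k => setcoord k ord0) (fun k => k j == ord0))/=; last first.
  by move=> k _; rewrite ffunE eqxx.
apply: (@le_trans _ _ (\sum_(k : {ffun 'I_d -> 'I_B.+1} | k j == ord0)
    c * \prod_(a | a != j) g (k a))).
  apply: ler_sum => k kj; apply: le_trans (fib k).
  rewrite (reindex_onto (setcoord k) (fun k' => k' j))/=; last first.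
    move=> k' /andP[_ /eqP <-]; apply/ffunP => a; rewrite !ffunE.
    by case: eqVneq => [->|].
  rewrite le_eqVlt; apply/orP; left; apply/eqP; apply: eq_bigl => x.
  have -> : setcoord (setcoord k x) ord0 = k.
    apply/ffunP => a; rewrite !ffunE; case: eqVneq => [->|//].
    by rewrite (eqP kj).
  by rewrite ffunE !eqxx !andbT.
rewrite -mulr_sumr ler_wpM2l//.
pose F (a : 'I_d) (x : 'I_B.+1) : R := if a == j then 1 else g x.
pose Q (a : 'I_d) (x : 'I_B.+1) := (a == j) ==> (x == ord0).
rewrite (eq_bigr (fun k : {ffun 'I_d -> 'I_B.+1} => \prod_a F a (k a))); last first.
  move=> k _; rewrite [RHS](bigD1 j)//= {1}/F eqxx mul1r.
  by apply: eq_bigr => a aj; rewrite /F (negbTE aj).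
rewrite (eq_bigl (fun k : {ffun 'I_d -> 'I_B.+1} => k \in family Q)); last first.
  move=> k; apply/idP/familyP => [kj a|/(_ j)]; last by rewrite unfold_in /Q eqxx.
  by rewrite unfold_in /Q; apply/implyP => /eqP ->.
rewrite -(bigA_distr_big_dep Q F).
have -> : W ^+ d = \prod_(a < d) W by rewrite prodr_const card_ord.
apply: ler_prod => a _; rewrite /Q /F; case: eqVneq => [_|_] /=.
  by rewrite big_pred1_eq W1 ler01.
by rewrite gW andbT sumr_ge0.
Qed.
End fiber.

(** The set of [k] with [prod_a (1 / weight (k_a)) <= M], up to logarithms; this
    variant, in which one coordinate is compared with the weights of the others,
    is the one for which counting and tails reduce to sums over one coordinate. *)
Definition in_cross (s M : R) (k : 'I_d -> nat) : bool :=
  [exists j, (k j).+1%:R <= M * \prod_(a | a != j) weight s (k a)].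

Lemma in_cross_bounded s M k : 0 <= s -> in_cross s M k ->
  forall a, (k a).+1%:R <= M.
Proof.
move=> s0 /existsP[j kj] a.
have w1 (Q : pred 'I_d) : \prod_(a | Q a) weight s (k a) <= 1 :> R.
  by apply: Num.Theory.prodr_ile1 => b _; rewrite weight_le1// ltW// weight_gt0.
have w0 (Q : pred 'I_d) : 0 < \prod_(a | Q a) weight s (k a) :> R.
  by apply: prodr_gt0 => b _; rewrite weight_gt0.
have M0 : 0 < M.
  by rewrite -(pmulr_lgt0 _ (w0 (fun a => a != j)))// (lt_le_trans _ kj).
have [->|aj] := eqVneq a j; first by rewrite (le_trans kj)// ler_piMr// ltW.
have : 1 <= M * weight s (k a).
  apply: le_trans (le_trans kj _); first by rewrite ler1n.
  rewrite (bigD1 a)//= ler_pM2l// ler_piMr// ltW//; exact: weight_gt0.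
move=> /le_trans/(_ (ler_wpM2l (ltW M0) (weight_le s (k a) s0))).
by rewrite ler_pdivlMr ?ltr0n// mul1r.
Qed.

Lemma in_cross0 s M : (0 < d)%N -> 1 <= M -> in_cross s M (fun=> 0%N).
Proof.
move=> d0 M1; apply/existsP; exists (Ordinal d0).
by rewrite big1 ?mulr1// => a _; exact: weight0.
Qed.

(** Given the coordinates other than [j], at most [M] times the product of
    their weights values of [k_j] are admissible; the weights are summable. *)
Lemma card_cross_le s : 1 < s -> exists2 c, 0 < c & forall M B, 0 <= M ->
  (#|[pred k : {ffun 'I_d -> 'I_B.+1} | in_cross s M (fun a => k a)]|)%:R <= c * M.
Proof.
move=> s1; have [W W1 sumW] := @sum_weight R s s1.
exists (d.+1%:R * W ^+ d); first by rewrite mulr_gt0// exprn_gt0// (lt_le_trans _ W1).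
move=> M B M0.
have h j : \sum_(k : {ffun 'I_d -> 'I_B.+1} |
      (k j).+1%:R <= M * \prod_(a | a != j) weight s (k a)) 1 <= M * W ^+ d.
  apply: (@sum_fibers B j _ _ (weight s) M) => // [i|k]; first exact/ltW/weight_gt0.
  set y := M * _.
  have y0 : 0 <= y.
    by rewrite mulr_ge0// prodr_ge0// => i _; exact/ltW/weight_gt0.
  rewrite (eq_bigl (fun x : 'I_B.+1 => x.+1%:R <= y)); last first.
    move=> x; rewrite ffunE eqxx /y; congr (_ <= _ * _).
    by apply: eq_bigr => a aj; rewrite ffunE (negbTE aj).
  elim: B.+1 => [|n IH]; first by rewrite big_ord0.
  rewrite big_mkcond big_ord_recr/= -big_mkcond/=.
  case: ifPn => [yn|]; last by rewrite addr0.
  apply: le_trans yn; rewrite -natr1 lerD2r.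
  rewrite big_mkcond/= [leRHS](_ : _ = \sum_(i < n) 1); last first.
    by rewrite sumr_const card_ord.
  by apply: ler_sum => i _; case: ifP.
apply: (@le_trans _ _ (\sum_(j < d) (M * W ^+ d))); last first.
  rewrite sumr_const card_ord -[leLHS]mulr_natl.
  rewrite [leRHS](_ : _ = d.+1%:R * (M * W ^+ d)); last by ring.
  by rewrite ler_wpM2r ?ler_nat// mulr_ge0// exprn_ge0// (le_trans ler01 W1).
apply: (@le_trans _ _ (\sum_(j < d) _)); last by apply: ler_sum => j _; exact: h.
rewrite -sum1_card natr_sum/=.
rewrite (eq_bigr (fun j => \sum_(k : {ffun 'I_d -> 'I_B.+1})
   if (k j).+1%:R <= M * \prod_(a | a != j) weight s (k a) then 1 else 0)); last first.
  by move=> j _; rewrite big_mkcond.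
rewrite exchange_big/= big_mkcond/=; apply: ler_sum => k _; rewrite inE.
have ge0 (Q : pred 'I_d) : 0 <= \sum_(i < d | Q i)
    (if (k i).+1%:R <= M * \prod_(a | a != i) weight s (k a) then 1 else 0) :> R.
  by apply: sumr_ge0 => i _; case: ifP.
case: ifPn => [/existsP[j kj]|_]; last exact: ge0.
by rewrite (bigD1 j)//= kj lerDl ge0.
Qed.

(** Outside the cross the defining inequality fails in every coordinate, and it
    is used for a largest one.  Its value [z] then exceeds a fixed power of [M],
    which turns its logarithmic weight into a power of [1 + ln M]; the sum of
    [z^(- p)] over [z > M prod_(a != j) weight (k_a)] leaves the first power of
    the other weights, which are summable. *)
Lemma sum_outside_cross {s p : R} : (0 < d)%N -> 1 < s -> 1 < p ->
  exists2 C, 0 < C &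
  forall M B, 1 <= M ->
  \sum_(k : {ffun 'I_d -> 'I_B.+1} | ~~ in_cross s M (fun a => k a))
     \prod_a weight s (k a) `^ p <= C * M `^ (1 - p) * (1 + ln M) `^ (- (s * p)).
Proof.
move=> d0 s1 p1; have [W W1 sumW] := @sum_weight R s s1.
have [C C0 sumC] := @sum_powR_tail R p p1.
have s0 : 0 <= s by lra.
have p0 : 0 <= p by lra.
have sp0 : 0 <= s * p by rewrite mulr_ge0.
have W0 : 0 < W by rewrite (lt_le_trans _ W1).
pose D : R := 1 + (1 + s) * d%:R.
have D1 : 1 <= D by rewrite lerDl mulr_ge0// addr_ge0.
have D0 : 0 < D by rewrite (lt_le_trans _ D1).
exists (d.+1%:R * (D `^ (s * p) * C * W ^+ d)).
  by rewrite !mulr_gt0// ?powR_gt0// exprn_gt0.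
move=> M B M1; have M0 : 0 < M by rewrite (lt_le_trans _ M1).
set L := 1 + ln M.
have L1 : 1 <= L by rewrite lerDl ln_ge0.
have L0 : 0 < L by rewrite (lt_le_trans _ L1).
pose top (j : 'I_d) (k : {ffun 'I_d -> 'I_B.+1}) :=
  [&& ~~ in_cross s M (fun a => k a) & [forall a, (k a <= k j)%N]].
(* [weight_ge] and maximality of [k j] give [M <= (k j + 1)^D]. *)
have topP j k : top j k -> M * \prod_(a | a != j) weight s (k a) < (k j).+1%:R
    /\ L / D <= loglen (k j).
  move=> /andP[/existsPn/(_ j)]; rewrite -ltNge => kj /forallP kmax.
  split => //; set z := (k j).+1%:R in kj *.
  have z1 : 1 <= z by rewrite ler1n.
  have z0 : 0 < z by rewrite (lt_le_trans _ z1).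
  have : M <= z `^ D.
    rewrite /D powRD ?(gt_eqF z0) ?implybT// powRr1 ?(ltW z0)//.
    rewrite -ler_pdivrMr ?powR_gt0//; apply: le_trans (ltW kj).
    rewrite ler_pM2l// powRrM powR_mulrn ?powR_ge0//.
    rewrite -exprVn -powRN.
    apply: (@le_trans _ _ (\prod_(a < d | a != j) z `^ (- (1 + s)))).
      rewrite prodr_const; apply: ler_wiXn2l; rewrite ?powR_ge0//.
        by rewrite powRN invf_le1 ?powR_gt0// -[leLHS](powRr0 z) ler_powR//; lra.
      by rewrite (leq_trans (max_card _))// card_ord.
    apply: ler_prod => a aj; rewrite powR_ge0/=.
    apply: le_trans (weight_ge s (k a) s0); apply: powR_le_neg => //; last by lra.
    by rewrite ler_nat ltnS.
  move=> Mz; have lnM : ln M <= D * ln z by rewrite -ln_powR ler_ln ?posrE ?powR_gt0.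
  rewrite ler_pdivrMr// /loglen -/z mulrDl mul1r [ln z * D]mulrC.
  exact: lerD.
have h j : \sum_(k | top j k) \prod_a weight s (k a) `^ p <=
    D `^ (s * p) * L `^ (- (s * p)) * C * M `^ (1 - p) * W ^+ d.
  apply: (@sum_fibers B j _ _ (weight s)) => // [i||k _|k].
  - exact/ltW/weight_gt0.
  - by rewrite !mulr_ge0 ?powR_ge0// ltW.
  - by rewrite prodr_ge0// => a _; rewrite powR_ge0.
  set v := \prod_(a | a != j) weight s (k a).
  have v0 : 0 < v by apply: prodr_gt0 => a _; exact: weight_gt0.
  have vE x : \prod_(a | a != j) weight s (setcoord j k x a) = v.
    by apply: eq_bigr => a aj; rewrite ffunE (negbTE aj).
  have y0 : 0 < M * v by rewrite mulr_gt0.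
  apply: (@le_trans _ _ (\sum_(x < B.+1 | M * v < x.+1%:R)
      D `^ (s * p) * L `^ (- (s * p)) * v `^ p * x.+1%:R `^ (- p))).
    rewrite big_mkcond [leRHS]big_mkcond/=; apply: ler_sum => x _.
    case: ifPn => [/topP[]|_]; last first.
      by case: ifP => // _; rewrite !mulr_ge0 ?powR_ge0.
    rewrite vE ffunE eqxx => -> Lx.
    rewrite (bigD1 j)//= ffunE eqxx.
    have -> : \prod_(i | i != j) weight s (setcoord j k x i) `^ p = v `^ p.
      by rewrite prod_powR ?vE// => i; exact/ltW/weight_gt0.
    rewrite [leRHS]mulrAC ler_pM2r ?powR_gt0//.
    rewrite /weight -powR_inv1 ?mulr_ge0 ?powR_ge0// -powRrM mulN1r.
    rewrite powRM ?powR_ge0// -powRrM mulrC ler_wpM2r ?powR_ge0//.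
    rewrite mulrN; apply: le_trans (powR_le_neg _ Lx sp0) _; first by rewrite divr_gt0.
    rewrite powRM ?invr_ge0 ?(ltW L0) ?(ltW D0)// -[D^-1]powR_inv1 ?(ltW D0)// -powRrM.
    by rewrite mulN1r opprK [leLHS]mulrC.
  rewrite -mulr_sumr.
  apply: le_trans (ler_wpM2l _ (sumC _ y0 B.+1)) _; first by rewrite !mulr_ge0 ?powR_ge0.
  rewrite powRM ?(ltW M0) ?(ltW v0)//.
  have vp : v `^ p * v `^ (1 - p) = v.
    by rewrite -powRD ?(gt_eqF v0) ?implybT// subrKC powRr1// ltW.
  rewrite le_eqVlt; apply/orP; left; apply/eqP.
  by rewrite -[RHS]/(_ * v) -[in RHS]vp; ring.
set V := _ * W ^+ d in h.
apply: (@le_trans _ _ (\sum_(j < d) V)); last first.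
  rewrite sumr_const card_ord -[leLHS]mulr_natl.
  rewrite [leRHS](_ : _ = d.+1%:R * V); last by rewrite /V; ring.
  by rewrite ler_wpM2r ?ler_nat// /V !mulr_ge0 ?powR_ge0 ?exprn_ge0// ltW.
apply: (@le_trans _ _ (\sum_(j < d) _)); last by apply: ler_sum => j _; exact: h.
rewrite (eq_bigr (fun j => \sum_(k : {ffun 'I_d -> 'I_B.+1})
   if top j k then \prod_a weight s (k a) `^ p else 0)); last first.
  by move=> j _; rewrite big_mkcond.
rewrite exchange_big/= big_mkcond/=; apply: ler_sum => k _.
have w0 : 0 <= \prod_a weight s (k a) `^ p by apply: prodr_ge0 => a _; exact: powR_ge0.
have ge0 (Q : pred 'I_d) : 0 <= \sum_(i < d | Q i)
    (if top i k then \prod_a weight s (k a) `^ p else 0).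
  by apply: sumr_ge0 => i _; case: ifP.
case: ifPn => [kM|_]; last exact: ge0.
have [j _ jmax] := @arg_maxnP _ (Ordinal d0) xpredT (fun a => k a : nat) isT.
have jk : top j k by rewrite /top kM; apply/forallP => a; exact: jmax.
by rewrite [leRHS](bigD1 j)//= jk lerDl ge0.
Qed.
End crosses.

(** * Integrals of squares of orthonormal sums and of products *)

Section orthonormal_sums.
Context {R : realType} {dT} {T : measurableType dT}.
Variables (mu : {measure set T -> \bar R}) (D : set T).
Hypothesis mD : measurable D.

(** Square integrability of both factors makes their product integrable, by
    [2 u v <= u^2 + v^2]. *)
Lemma integrable_mul_sq (u v : T -> R) :
  measurable_fun D u -> measurable_fun D v ->
  (\int[mu]_(x in D) (u x ^+ 2)%:E < +oo)%E ->
  (\int[mu]_(x in D) (v x ^+ 2)%:E < +oo)%E ->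
  mu.-integrable D (fun x => (u x * v x)%:E).
Proof.
move=> mu_ mv u2 v2.
have msq (w : T -> R) : measurable_fun D w -> measurable_fun D (EFin \o (fun x => w x ^+ 2)).
  by move=> mw; apply/measurable_EFinP; exact: measurable_funX.
apply/integrableP; split; first by apply/measurable_EFinP; exact: measurable_funM.
apply: (@le_lt_trans _ _ (\int[mu]_(x in D) ((u x ^+ 2)%:E + (v x ^+ 2)%:E))%E).
  apply: ge0_le_integral => //.
  - apply: measurableT_comp => //; apply/measurable_EFinP; exact: measurable_funM.
  - by apply: emeasurable_funD; exact: msq.
  - move=> x _; rewrite /= -EFinD lee_fin normrM.
    have := sqr_ge0 (`|u x| - `|v x|).
    rewrite sqrrB !real_normK ?num_real// => h.
    have : 0 <= `|u x| * `|v x| by rewrite mulr_ge0.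
    lra.
rewrite ge0_integralD//; [|by move=> x _; rewrite lee_fin sqr_ge0|exact: msq
  |by move=> x _; rewrite lee_fin sqr_ge0|exact: msq].
by rewrite lte_add_pinfty.
Qed.

(** Parseval for finite sums.  It is used in the cube for the tensor basis, and
    on the probability space for the uncorrelated coefficients. *)
Lemma integral_orthonormal_sum {I : eqType} (u : I -> T -> R) (c : I -> R) (s : seq I) :
  (forall i, measurable_fun D (u i)) ->
  (forall i j, \int[mu]_(x in D) (u i x * u j x)%:E = ((i == j)%:R)%:E)%E ->
  uniq s ->
  (\int[mu]_(x in D) ((\sum_(i <- s) c i * u i x) ^+ 2)%:E
    = (\sum_(i <- s) c i ^+ 2)%:E)%E.
Proof.
move=> mu_ orth us.
have int i j : mu.-integrable D (fun x => (u i x * u j x)%:E).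
  apply: integrable_mul_sq => //; under eq_integral do rewrite expr2;
  by rewrite orth eqxx ltry.
have int2 i j : mu.-integrable D (fun x => (c i * c j)%:E * (u i x * u j x)%:E)%E.
  exact: integrableZl.
under eq_integral => x _.
  have -> : ((\sum_(i <- s) c i * u i x) ^+ 2)%:E =
     (\sum_(i <- s) \sum_(j <- s) (c i * c j)%:E * (u i x * u j x)%:E)%E.
    rewrite expr2 big_distrlr/= -sumEFin; apply: eq_bigr => i _.
    rewrite -sumEFin; apply: eq_bigr => j _; rewrite -EFinM; congr EFin; ring.
  over.
rewrite integral_sum//; last by move=> i; exact: integrable_sum.
rewrite -sumEFin; apply: eq_big_seq => i si.
rewrite integral_sum// (bigD1_seq i)//= integralZl// orth eqxx mule1 -expr2.
rewrite big1 ?adde0// => j /negbTE ji.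
by rewrite integralZl// orth eq_sym ji mule0.
Qed.

End orthonormal_sums.

Section tensor.
Context {R : realType} {d1 d2} {T1 : measurableType d1} {T2 : measurableType d2}.
Variables (m1 : {sigma_finite_measure set T1 -> \bar R}).
Variables (m2 : {sigma_finite_measure set T2 -> \bar R}).

Lemma integrable_tensor (f : T1 -> R) (g : T2 -> R) :
  m1.-integrable setT (EFin \o f) -> m2.-integrable setT (EFin \o g) ->
  (m1 \x m2)%E.-integrable setT (fun z => (f z.1 * g z.2)%:E).
Proof.
move=> /integrableP[/measurable_EFinP mf fo] /integrableP[/measurable_EFinP mg go].
apply/integrable12ltyP.
  apply/measurable_EFinP; apply: measurable_funM; exact: measurableT_comp.
have -> : (\int[m1]_x \int[m2]_y `|(f (x, y).1 * g (x, y).2)%:E| =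
   \int[m1]_x (`|(f x)%:E| * \int[m2]_y `|(g y)%:E|))%E.
  apply: eq_integral => x _; rewrite -ge0_integralZl//; first last.
    by apply: measurableT_comp => //; exact/measurable_EFinP.
  by apply: eq_integral => y _; rewrite /= normrM EFinM.
rewrite ge0_integralZr//; last 2 first.
- by apply: measurableT_comp => //; exact/measurable_EFinP.
- exact: integral_ge0.
by rewrite lte_mul_pinfty// ?ge0_fin_numE// integral_ge0.
Qed.

Lemma integral_tensor (f : T1 -> R) (g : T2 -> R) (a b : R) :
  m1.-integrable setT (EFin \o f) -> m2.-integrable setT (EFin \o g) ->
  (\int[m1]_x (f x)%:E = a%:E -> \int[m2]_x (g x)%:E = b%:E ->
  \int[(m1 \x m2)]_z (f z.1 * g z.2)%:E = (a * b)%:E)%E.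
Proof.
move=> fi gi fa gb.
rewrite -(integral12_prod_meas1 (integrable_tensor _ _ fi gi)) /fubini_F/=.
under eq_integral => x _ do [under eq_integral => y _ do rewrite EFinM;
  rewrite integralZl// gb].
by rewrite integralZr// fa.
Qed.

End tensor.

Section tuple_products.
Context {R : realType} {d} {T : measurableType d}.
Variable mu : {sigma_finite_measure set T -> \bar R}.

Lemma measurable_tuple_prod n (f : 'I_n -> T -> R) :
  (forall i, measurable_fun setT (f i)) ->
  measurable_fun setT (fun t : n.-tuple T => \prod_i f i (tnth t i)).
Proof.
move=> mf; apply: measurable_prod => i _.
by apply: (measurableT_comp (mf i)); exact: measurable_tnth.
Qed.

(** Fubini for products of functions of one coordinate; integrability is
    carried along in the induction, as the factors have no sign. *)
Lemma integral_tuple_prod n (f : 'I_n -> T -> R) (a : 'I_n -> R) :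
  (forall i, mu.-integrable setT (EFin \o f i)) ->
  (forall i, \int[mu]_x (f i x)%:E = (a i)%:E)%E ->
  (tuple_measure mu n).-integrable setT
     (fun t : n.-tuple T => (\prod_i f i (tnth t i))%:E) /\
  (\int[tuple_measure mu n]_t (\prod_i f i (tnth t i))%:E = (\prod_i a i)%:E)%E.
Proof.
elim: n f a => [|n IH] f a fi fa.
  have E : (fun t : 0.-tuple T => (\prod_(i < 0) f i (tnth t i))%:E) = cst 1%E.
    by apply/funext => t; rewrite big_ord0.
  rewrite big_ord0 E /=; split.
    apply/integrableP; split => //; under eq_integral do rewrite /= normr1.
    by rewrite integral_dirac// diracT mul1e ltry.
  by rewrite integral_dirac// diracT mul1e.
have mf i : measurable_fun setT (f i).
  by have /integrableP[/measurable_EFinP] := fi i.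
have [IHi IHv] := IH (fun i => f (lift ord0 i)) (fun i => a (lift ord0 i))
  (fun i => fi _) (fun i => fa _).
pose g (t : n.-tuple T) := \prod_i f (lift ord0 i) (tnth t i).
have E : (fun t : n.+1.-tuple T => (\prod_i f i (tnth t i))%:E) \o
    (cons_pair (n := n)) = fun z => (f ord0 z.1 * g z.2)%:E.
  apply/funext => -[x t] /=; rewrite big_ord_recl /g; congr (_ * _)%:E.
  by apply: eq_bigr => i _; rewrite tnthS.
have mp : measurable_fun setT
    (EFin \o (fun t : n.+1.-tuple T => \prod_i f i (tnth t i))).
  by apply/measurable_EFinP; exact: measurable_tuple_prod.
have ti := integrable_tensor _ _ _ _ (fi ord0) IHi.
split.
  apply: (@integrable_pushforward _ _ _ _ _ _ (@measurable_cons_pair _ _ n)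
    (mu \x tuple_measure mu n)%E) => //.
  by rewrite preimage_setT E.
rewrite /= /tuple_measureS integral_pushforward//; last 2 first.
- exact: measurable_cons_pair.
- by rewrite preimage_setT E.
by rewrite preimage_setT E big_ord_recl; exact: integral_tensor.
Qed.

End tuple_products.

(** * Kaczmarz iteration driven by point values *)

Section tonelli_on.
Context {R : realType} {d1 d2} {T1 : measurableType d1} {T2 : measurableType d2}.
Variables (m1 : {sigma_finite_measure set T1 -> \bar R}).
Variables (m2 : {sigma_finite_measure set T2 -> \bar R}).
Variables (D : set T2) (F : T1 * T2 -> \bar R).
Hypothesis mD : measurable D.
Hypothesis mF : measurable_fun ([set: T1] `*` D) F.
Hypothesis F0 : forall z, (0 <= F z)%E.

Let G := F \_ ([set: T1] `*` D).

Let mG : measurable_fun setT G.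
Proof. by apply/(measurable_restrictT _ (measurableX measurableT mD)). Qed.

Let G0 z : (0 <= G z)%E.
Proof. by apply: erestrict_ge0. Qed.

Let GE y : (\int[m1]_x G (x, y) = ((fun y => \int[m1]_x F (x, y)) \_ D) y)%E.
Proof.
rewrite /G /patch /=; case: ifPn => yD.
  by apply: eq_integral => x _; rewrite in_setX /= yD in_setT.
apply: integral0_eq => x _; case: ifPn => //.
by rewrite in_setX /= (negbTE yD) andbF.
Qed.

Lemma measurable_fun_integral1 :
  measurable_fun D (fun y => \int[m1]_x F (x, y))%E.
Proof.
apply/(measurable_restrictT _ mD).
have := measurable_fun_fubini_tonelli_G (m1 := m1) G mG G0.
by apply: eq_measurable_fun => y _; rewrite /fubini_G GE.
Qed.

Lemma tonelli_on :
  (\int[m1]_x \int[m2]_(y in D) F (x, y) =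
   \int[m2]_(y in D) \int[m1]_x F (x, y))%E.
Proof.
rewrite [RHS]integral_mkcond.
transitivity (\int[m1]_x \int[m2]_y G (x, y))%E.
  apply: eq_integral => x _; rewrite integral_mkcond; apply: eq_integral => y _.
  by rewrite /G /patch in_setX /= in_setT.
by rewrite (fubini_tonelli G mG G0); apply: eq_integral => y _; rewrite GE.
Qed.

End tonelli_on.

Section projection.
Context {R : realFieldType} {I : finType}.
Implicit Types (x e : I -> R) (h : R).

(** Moving [x] along [e] so that its inner product with [e] becomes [h] is an
    orthogonal projection followed by an orthogonal shift, whence Pythagoras. *)
Lemma kaczmarz_identity x e h : \sum_i e i ^+ 2 != 0 ->
  \sum_i (x i + (h - \sum_j x j * e j) / (\sum_j e j ^+ 2) * e i) ^+ 2
    = \sum_i x i ^+ 2 - (\sum_j x j * e j) ^+ 2 / (\sum_j e j ^+ 2)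
      + h ^+ 2 / (\sum_j e j ^+ 2).
Proof.
set N := \sum_j e j ^+ 2 => N0; set q := \sum_j x j * e j.
set g := (h - q) / N.
have -> : \sum_i (x i + g * e i) ^+ 2 = \sum_i x i ^+ 2 + 2 * g * q + g ^+ 2 * N.
  rewrite /q /N !mulr_sumr -!big_split/=; apply: eq_bigr => i _; ring.
rewrite /g; field; exact: N0.
Qed.

(** The Cauchy-Schwarz inequality, read off from the identity with [h = 0]. *)
Lemma sum_mul_sq_le x e : (\sum_j x j * e j) ^+ 2 <= \sum_i x i ^+ 2 * \sum_j e j ^+ 2.
Proof.
rewrite -mulr_suml.
have [N0|N0] := eqVneq (\sum_j e j ^+ 2) 0.
  rewrite N0 mulr0 big1 ?expr0n// => j _.
  have /psumr_eq0P := N0 => /(_ (fun j _ => sqr_ge0 _))/(_ j isT)/eqP.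
  by rewrite sqrf_eq0 => /eqP ->; rewrite mulr0.
have := kaczmarz_identity x e 0 N0; rewrite expr0n mul0r addr0 => h.
rewrite -ler_pdivrMr; last by rewrite lt_def N0 sumr_ge0// => j _; exact: sqr_ge0.
by rewrite -subr_ge0 -h sumr_ge0// => j _; exact: sqr_ge0.
Qed.

End projection.

Section kaczmarz.
Context {R : realType} {dT} {T : measurableType dT} (P : probability T R).
Context {dO} {Om : measurableType dO} (nu : {sigma_finite_measure set Om -> \bar R}).
Context (D : set Om) (mD : measurable D) {I : finType} (e : I -> Om -> R).
Hypothesis me : forall i, measurable_fun D (e i).
Hypothesis orth : forall i j,
  (\int[nu]_(t in D) (e i t * e j t)%:E = ((i == j)%:R)%:E)%E.
Hypothesis e_gt0 : forall t, D t -> 0 < \sum_i e i t ^+ 2.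

Lemma integral_sum_sq : (\int[nu]_(t in D) (\sum_i e i t ^+ 2)%:E = (#|I|%:R)%:E)%E.
Proof.
under eq_integral do rewrite -sumEFin.
rewrite ge0_integral_sum//.
- under eq_bigr => i _ do
    [under eq_integral do rewrite expr2; rewrite orth eqxx].
  by rewrite sumEFin sumr_const.
- by move=> i; apply/measurable_EFinP; exact: measurable_funX.
- by move=> i t _; rewrite lee_fin sqr_ge0.
Qed.

Variable X : Om -> T -> R.
Hypothesis mX : forall t, D t -> measurable_fun setT (X t).
Variable s : I -> T -> R.
Hypothesis ms : forall i, measurable_fun setT (s i).
Variables (eta : Om -> \bar R) (H : R).
Hypothesis meta : measurable_fun D eta.
Hypothesis X_near : forall t, D t ->
  (\int[P]_w ((X t w - \sum_i s i w * e i t) ^+ 2)%:E <= eta t)%E.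
Hypothesis etaH : (\int[nu]_(t in D) eta t < H%:E)%E.

Let eta0 t : D t -> (0 <= eta t)%E.
Proof.
move=> Dt; apply: le_trans (X_near t Dt); apply: integral_ge0 => w _.
by rewrite lee_fin sqr_ge0.
Qed.

Let H0 : 0 < H.
Proof. by rewrite -lte_fin (le_lt_trans _ etaH)// integral_ge0. Qed.

(** Tonelli and Parseval: the mean over [t] of the squared value at [t] of a
    random combination is the mean square of its coefficients. *)
Lemma integral_quadratic_form (x : I -> T -> R) :
  (forall i, measurable_fun setT (x i)) ->
  measurable_fun D (fun t => \int[P]_w ((\sum_i x i w * e i t) ^+ 2)%:E)%E /\
  (\int[nu]_(t in D) \int[P]_w ((\sum_i x i w * e i t) ^+ 2)%:E
    = \int[P]_w (\sum_i x i w ^+ 2)%:E)%E.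
Proof.
move=> mx.
pose F (z : T * Om) : \bar R := ((\sum_i x i z.1 * e i z.2) ^+ 2)%:E.
have mF : measurable_fun ([set: T] `*` D) F.
  apply/measurable_EFinP; apply: measurable_funX; apply: measurable_sum => i.
  apply: measurable_funM.
    by apply: measurable_funTS; exact: measurableT_comp.
  apply: (measurable_comp mD) => //; last exact: measurable_funTS.
  by move=> _ [z [_ ?] <-].
have F0 z : (0 <= F z)%E by rewrite lee_fin sqr_ge0.
split; first exact: (@measurable_fun_integral1 _ _ _ _ _ P D F mD mF F0).
rewrite -(tonelli_on P nu D F mD mF F0) /F/=; apply: eq_integral => w _.
by rewrite (@integral_orthonormal_sum _ _ _ _ _ _ _ e (x ^~ w))// index_enum_uniq.
Qed.

Variable m : R.
Hypothesis mE : m = #|I|%:R.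
Hypothesis m0 : 0 < m.

(** One projection step at a well chosen point.  Integrating
    [kaczmarz_identity] over the randomness, the new error at [t] is
    [D0 - Q t / N t + Hh t / N t] with [N t = |e(t)|^2]; multiplied by [N t] and
    integrated over [t], this is at most [m D0 - D0 + H].  A point at which the
    integrand does not exceed that of the claimed bound must exist. *)
Lemma kaczmarz_step (a : I -> T -> R) :
  (forall i, measurable_fun setT (a i)) ->
  (\int[P]_w (\sum_i (a i w - s i w) ^+ 2)%:E < +oo)%E ->
  exists2 t, D t &
  (\int[P]_w (\sum_i (a i w + (X t w - \sum_j a j w * e j t) / (\sum_j e j t ^+ 2) * e i t
       - s i w) ^+ 2)%:E
   <= (1 - m^-1)%:E * \int[P]_w (\sum_i (a i w - s i w) ^+ 2)%:E + (H / m)%:E)%E.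
Proof.
move=> ma; pose x i w := a i w - s i w.
have mx i : measurable_fun setT (x i) by exact: measurable_funB.
rewrite -/(\int[P]_w (\sum_i x i w ^+ 2)%:E)%E.
set D0E := (\int[P]_w (\sum_i x i w ^+ 2)%:E)%E => D0oo.
have D0E0 : (0 <= D0E)%E.
  by apply: integral_ge0 => w _; rewrite lee_fin sumr_ge0// => i _; rewrite sqr_ge0.
have D0fin : D0E \is a fin_num by rewrite ge0_fin_numE.
pose D0 := fine D0E; have D0eq : D0E = D0%:E by rewrite fineK.
have D00 : 0 <= D0 by rewrite fine_ge0.
pose Q t := (\int[P]_w ((\sum_i x i w * e i t) ^+ 2)%:E)%E.
have [mQ QE] : measurable_fun D Q /\ (\int[nu]_(t in D) Q t = D0E)%E.
  exact: integral_quadratic_form.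
pose N t := \sum_i e i t ^+ 2.
have Q0 t : (0 <= Q t)%E by apply: integral_ge0 => w _; rewrite lee_fin sqr_ge0.
have mN : measurable_fun D N.
  by apply: measurable_sum => i; exact: measurable_funX.
have N0 t : 0 <= N t by rewrite sumr_ge0// => i _; rewrite sqr_ge0.
have mNc (c : R) : measurable_fun D (fun t => (N t * c)%:E).
  by apply/measurable_EFinP; exact: measurable_funM.
have NE c : 0 <= c -> (\int[nu]_(t in D) (N t * (c / m))%:E = c%:E)%E.
  move=> c0; under eq_integral do rewrite EFinM.
  rewrite ge0_integralZr//; last 3 first.
  - by apply/measurable_EFinP.
  - by move=> t _; rewrite lee_fin.
  - by rewrite lee_fin divr_ge0// ltW.
  by rewrite integral_sum_sq -mE -EFinM mulrC divfK ?gt_eqF.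
have intDN (f : Om -> \bar R) c : measurable_fun D f ->
    (forall t, D t -> 0 <= f t)%E -> 0 <= c ->
    (\int[nu]_(t in D) (f t + (N t * (c / m))%:E) = \int[nu]_(t in D) f t + c%:E)%E.
  move=> mf f0 c0; rewrite ge0_integralD// ?NE// => t _.
  by rewrite lee_fin mulr_ge0// divr_ge0// ltW.
(* Otherwise the reverse inequality holds at all points of [D]; integrating it
   gives [D0 + H <= \int eta + D0], against the strict bound [etaH]. *)
have [t Dt ht] : exists2 t, D t &
   (eta t + (N t * (D0 / m))%:E <= Q t + (N t * (H / m))%:E)%E.
  apply: contrapT => /forall2NP noT.
  have lt t : D t -> (Q t + (N t * (H / m))%:E <= eta t + (N t * (D0 / m))%:E)%E.
    move=> Dt; have [//|/negP] := noT t; by rewrite -ltNge => /ltW.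
  have : (\int[nu]_(t in D) (Q t + (N t * (H / m))%:E) <=
          \int[nu]_(t in D) (eta t + (N t * (D0 / m))%:E))%E.
    apply: ge0_le_integral => //.
    - by move=> t _; rewrite adde_ge0// lee_fin mulr_ge0// divr_ge0// ltW.
    - exact: emeasurable_funD.
    - exact: emeasurable_funD.
  rewrite (intDN Q)// ?(ltW H0)// (intDN eta)// QE D0eq.
  by rewrite addeC leeD2rE// leNgt etaH.
exists t => //.
have Nt := e_gt0 t Dt; rewrite -/(N t) in Nt.
pose h w := X t w - \sum_i s i w * e i t.
have mh : measurable_fun setT h.
  apply: measurable_funB; first exact: mX.
  by apply: measurable_sum => i; exact: measurable_funM.
pose V := (\int[P]_w (\sum_i (x i w + (h w - \sum_j x j w * e j t) / N t * e i t) ^+ 2)%:E)%E.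
pose Hh := (\int[P]_w (h w ^+ 2)%:E)%E.
have -> : (\int[P]_w (\sum_i (a i w + (X t w - \sum_j a j w * e j t) /
      (\sum_j e j t ^+ 2) * e i t - s i w) ^+ 2)%:E)%E = V.
  apply: eq_integral => w _; congr EFin; apply: eq_bigr => i _; congr (_ ^+ 2).
  have -> : \sum_j x j w * e j t = \sum_j a j w * e j t - \sum_j s j w * e j t.
    by rewrite -sumrB; apply: eq_bigr => j _; rewrite mulrBl.
  rewrite /x /h /N; ring.
have msum : measurable_fun setT (fun w => \sum_i x i w * e i t).
  by apply: measurable_sum => i; exact: measurable_funM.
have mV : measurable_fun setT (fun w =>
    \sum_i (x i w + (h w - \sum_j x j w * e j t) / N t * e i t) ^+ 2).
  apply: measurable_sum => i; apply: measurable_funX; apply: measurable_funD => //.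
  apply: measurable_funM => //; apply: measurable_funM => //; exact: measurable_funB.
have mxx : measurable_fun setT (fun w => \sum_i x i w ^+ 2).
  by apply: measurable_sum => i; exact: measurable_funX.
have V0 : (0 <= V)%E.
  by apply: integral_ge0 => w _; rewrite lee_fin sumr_ge0// => i _; rewrite sqr_ge0.
have VQ : (V + Q t * (N t)^-1%:E = D0E + Hh * (N t)^-1%:E)%E.
  have Nv : (0 <= (N t)^-1%:E :> \bar R)%E by rewrite lee_fin invr_ge0.
  rewrite /Q /Hh -!ge0_integralZr//; try (by move=> w _; rewrite lee_fin sqr_ge0);
    try (by apply/measurable_EFinP; exact: measurable_funX).
  rewrite /V /D0E -!ge0_integralD//;
   try (by move=> w _; rewrite mule_ge0// lee_fin sqr_ge0);
   try (by move=> w _; rewrite lee_fin sumr_ge0// => i _; rewrite sqr_ge0);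
   try (by apply/measurable_EFinP; exact: measurable_funX);
   try (by apply/measurable_EFinP);
   try (by apply: emeasurable_funM => //; apply/measurable_EFinP; exact: measurable_funX).
  apply: eq_integral => w _; rewrite -!EFinM -!EFinD; congr EFin.
  have /= := kaczmarz_identity (x ^~ w) (e ^~ t) (h w) (lt0r_neq0 Nt).
  by rewrite -/(N t) => ->; ring.
have Qoo : (Q t < +oo)%E.
  apply: (@le_lt_trans _ _ (D0E * (N t)%:E)%E); last by rewrite D0eq -EFinM ltry.
  rewrite /D0E -ge0_integralZr ?lee_fin//; last 2 first.
  - by apply/measurable_EFinP.
  - by move=> w _; rewrite lee_fin sumr_ge0// => i _; rewrite sqr_ge0.
  apply: ge0_le_integral => //.
  - by move=> w _; rewrite lee_fin sqr_ge0.
  - by apply/measurable_EFinP; exact: measurable_funX.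
  - by apply: emeasurable_funM => //; apply/measurable_EFinP.
  - move=> w _; rewrite -EFinM lee_fin; have := sum_mul_sq_le (x ^~ w) (e ^~ t).
    by rewrite -mulr_suml.
have Qfin : Q t \is a fin_num by rewrite ge0_fin_numE.
have etafin : eta t \is a fin_num.
  rewrite ge0_fin_numE ?eta0//.
  have : (eta t + (N t * (D0 / m))%:E < +oo)%E.
    by rewrite (le_lt_trans ht)// lte_add_pinfty// ltry.
  by apply: le_lt_trans; rewrite leeDl// lee_fin mulr_ge0// divr_ge0// ltW.
have Hhle : (Hh <= eta t)%E by exact: X_near.
have Hhfin : Hh \is a fin_num.
  rewrite ge0_fin_numE; first by rewrite (le_lt_trans Hhle)// -ge0_fin_numE// eta0.
  by apply: integral_ge0 => w _; rewrite lee_fin sqr_ge0.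
have Vfin : V \is a fin_num.
  rewrite ge0_fin_numE//.
  have : (V + Q t * (N t)^-1%:E < +oo)%E.
    by rewrite VQ D0eq -(fineK Hhfin) -EFinM -EFinD ltry.
  by apply: le_lt_trans; rewrite leeDl// mule_ge0// lee_fin invr_ge0.
move: VQ ht Hhle; rewrite D0eq -(fineK Qfin) -(fineK Hhfin) -(fineK etafin) -(fineK Vfin).
rewrite -!EFinM -!EFinD !lee_fin => -[].
move: (fine V) (fine (Q t)) (fine Hh) (fine (eta t)) => v q hh et.
move: (N t) Nt D0 {D0eq D00} => n n0 d VQ ht hhet.
rewrite -(ler_pM2l n0).
have {}VQ : n * v = n * d + hh - q.
  have -> : v = d + hh / n - q / n by rewrite -VQ; ring.
  by field; rewrite gt_eqF.
rewrite VQ.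
have -> : n * ((1 - m^-1) * d + H / m) = n * d + n * (H / m) - n * (d / m) by ring.
lra.
Qed.

(** Iterating the step.  The coefficients stay linear in the point values: the
    new point enters with [e(t) / |e(t)|^2], and each old coefficient vector is
    replaced by its projection orthogonal to [e(t)]. *)
Lemma kaczmarz_coefficients (S0 : R) (t0 : Om) (n : nat) : D t0 -> 1 <= m ->
  (\int[P]_w (\sum_i s i w ^+ 2)%:E <= S0%:E)%E ->
  exists (tau : nat -> Om) (c : nat -> I -> R), (forall l, D (tau l)) /\
  (\int[P]_w (\sum_i (\sum_(l < n) c l i * X (tau l) w - s i w) ^+ 2)%:E
    <= (H + (1 - m^-1) ^+ n * S0)%:E)%E.
Proof.
move=> Dt0 m1 sS0; have mv1 : 0 <= 1 - m^-1 by rewrite subr_ge0 invf_le1.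
elim: n => [|n [tau [c [Dtau IH]]]].
  exists (fun=> t0), (fun _ _ => 0); split=> //.
  rewrite expr0 mul1r (_ : (fun w => _) = (fun w => (\sum_i s i w ^+ 2)%:E)).
    by rewrite (le_trans sS0)// lee_fin lerDr ltW.
  apply/funext => w; congr EFin; apply: eq_bigr => i _.
  by rewrite big_ord0 sub0r sqrrN.
pose a i w := \sum_(l < n) c l i * X (tau l) w.
have ma i : measurable_fun setT (a i).
  by apply: measurable_sum => l; apply: measurable_funM => //; exact: mX.
have [t Dt ht] := kaczmarz_step a ma (le_lt_trans IH (ltry _)).
exists (fun l => if l == n then t else tau l).
exists (fun l i => if l == n then e i t / (\sum_j e j t ^+ 2) else
   c l i - (\sum_j c l j * e j t) / (\sum_j e j t ^+ 2) * e i t).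
split; first by move=> l; case: ifP.
apply: (@le_trans _ _ ((1 - m^-1)%:E * (H + (1 - m^-1) ^+ n * S0)%:E + (H / m)%:E)%E).
  apply: le_trans (le_trans ht _); last by rewrite leeD2r// lee_wpmul2l// lee_fin.
  rewrite le_eqVlt; apply/orP; left; apply/eqP; apply: eq_integral => w _.
  congr EFin; apply: eq_bigr => i _; congr ((_ - _) ^+ 2).
  rewrite big_ord_recr/= eqxx.
  under eq_bigr => l _ do rewrite ltn_eqF// mulrBl.
  rewrite sumrB -/(a i w) -addrA; congr (_ + _).
  have -> : \sum_j a j w * e j t = \sum_(l < n) (\sum_j c l j * e j t) * X (tau l) w.
    under eq_bigr => j _ do rewrite mulr_suml.
    rewrite exchange_big/=; apply: eq_bigr => l _; rewrite mulr_suml.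
    by apply: eq_bigr => j _; rewrite mulrAC.
  set N := \sum_j e j t ^+ 2.
  have -> : \sum_(l < n) (\sum_j c l j * e j t) / N * e i t * X (tau l) w =
     (\sum_(l < n) (\sum_j c l j * e j t) * X (tau l) w) * (N^-1 * e i t).
    by rewrite mulr_suml; apply: eq_bigr => l _; ring.
  ring.
rewrite -EFinM -EFinD lee_fin exprS; lra.
Qed.

Hypothesis mXj : measurable_fun ([set: T] `*` D) (fun wt => X wt.2 wt.1).

(** The error of the algorithm is at most twice the error of the ideal
    approximation [\sum_i s i * e i] plus twice that of its coefficients. *)
Lemma kaczmarz_error (S0 : R) (t0 : Om) (n : nat) : D t0 -> 1 <= m ->
  (\int[P]_w (\sum_i s i w ^+ 2)%:E <= S0%:E)%E ->
  exists (tau : nat -> Om) (c : nat -> I -> R), (forall l, D (tau l)) /\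
  (\int[P]_w \int[nu]_(t in D)
     ((X t w - \sum_(l < n) X (tau l) w * (\sum_i c l i * e i t)) ^+ 2)%:E
    <= (4 * H + 2 * ((1 - m^-1) ^+ n * S0))%:E)%E.
Proof.
move=> Dt0 m1 sS0; have [tau [c [Dtau err]]] := kaczmarz_coefficients S0 t0 n Dt0 m1 sS0.
exists tau, c; split=> //.
pose x i w := \sum_(l < n) c l i * X (tau l) w - s i w.
have mx i : measurable_fun setT (x i).
  apply: measurable_funB => //; apply: measurable_sum => l.
  by apply: measurable_funM => //; exact: mX.
pose F (z : T * Om) : \bar R :=
  ((X z.2 z.1 - \sum_(l < n) X (tau l) z.1 * (\sum_i c l i * e i z.2)) ^+ 2)%:E.
have mF : measurable_fun ([set: T] `*` D) F.
  apply/measurable_EFinP; apply: measurable_funX; apply: measurable_funB => //.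
  apply: measurable_sum => l; apply: measurable_funM.
    by apply: measurable_funTS; apply: (measurableT_comp (mX _ (Dtau l))).
  apply: (measurable_comp mD (f := fun t => \sum_i c l i * e i t)).
  - by move=> _ [z [_ ?] <-].
  - by apply: measurable_sum => i; exact: measurable_funM.
  - exact: measurable_funTS.
have F0 z : (0 <= F z)%E by rewrite lee_fin sqr_ge0.
rewrite (tonelli_on P nu D F mD mF F0).
have mG := measurable_fun_integral1 P D F mD mF F0.
pose Q t := (\int[P]_w ((\sum_i x i w * e i t) ^+ 2)%:E)%E.
have [mQ QE] : measurable_fun D Q /\
    (\int[nu]_(t in D) Q t = \int[P]_w (\sum_i x i w ^+ 2)%:E)%E.
  exact: integral_quadratic_form.
have Q0 t : (0 <= Q t)%E by apply: integral_ge0 => w _; rewrite lee_fin sqr_ge0.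
apply: (@le_trans _ _ (\int[nu]_(t in D) (2%:E * eta t + 2%:E * Q t))%E).
  apply: ge0_le_integral => //.
  - by move=> t _; apply: integral_ge0.
  - by apply: emeasurable_funD; exact: measurable_funeM.
  move=> t Dt; pose h w := X t w - \sum_i s i w * e i t.
  have mh : measurable_fun setT h.
    apply: measurable_funB; first exact: mX.
    by apply: measurable_sum => i; exact: measurable_funM.
  have msum : measurable_fun setT (fun w => \sum_i x i w * e i t).
    by apply: measurable_sum => i; exact: measurable_funM.
  apply: (@le_trans _ _ (\int[P]_w (2%:E * (h w ^+ 2)%:E +
      2%:E * ((\sum_i x i w * e i t) ^+ 2)%:E))%E).
    apply: ge0_le_integral => //.
    - apply: (measurable_comp (measurableX measurableT mD) _ mF).
        by move=> _ [w _ <-].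
      exact: (measurable_fun_pair (f := id) (g := cst t)).
    - apply: emeasurable_funD; apply: measurable_funeM; apply/measurable_EFinP;
        exact: measurable_funX.
    - move=> w _; rewrite /F /= -!EFinM -EFinD lee_fin.
      have -> : X t w - \sum_(l < n) X (tau l) w * (\sum_i c l i * e i t) =
          h w - \sum_i x i w * e i t.
        have -> : \sum_i x i w * e i t =
            \sum_i (\sum_(l < n) c l i * X (tau l) w) * e i t - \sum_i s i w * e i t.
          by rewrite -sumrB; apply: eq_bigr => i _; rewrite -mulrBl.
        rewrite /h opprB addrA subrK; congr (_ - _).
        under [RHS]eq_bigr do rewrite mulr_suml.
        rewrite [RHS]exchange_big/=; apply: eq_bigr => l _.
        by rewrite mulr_sumr; apply: eq_bigr => i _; ring.
      move: (h w) (\sum_i _) => u v.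
      have := sqr_ge0 (u + v); rewrite sqrrD sqrrB; lra.
  rewrite ge0_integralD//; try (by move=> w _; rewrite mule_ge0// lee_fin sqr_ge0);
    try (by apply: measurable_funeM; apply/measurable_EFinP; exact: measurable_funX).
  rewrite !ge0_integralZl//; try (by move=> w _; rewrite lee_fin sqr_ge0);
    try (by apply/measurable_EFinP; exact: measurable_funX).
  by rewrite leeD2r// lee_pmul2l// X_near.
have eta2 t : D t -> (0 <= 2%:E * eta t)%E by move=> Dt; rewrite mule_ge0// eta0.
have Q2 t : D t -> (0 <= 2%:E * Q t)%E by move=> Dt; rewrite mule_ge0.
have m2 (f : Om -> \bar R) : measurable_fun D f -> measurable_fun D (fun t => 2%:E * f t)%E.
  by move=> mf; exact: measurable_funeM.
rewrite (ge0_integralD nu mD eta2 (m2 eta meta) Q2 (m2 Q mQ)).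
rewrite (ge0_integralZl nu mD meta eta0)// (ge0_integralZl nu mD mQ (fun t _ => Q0 t))// QE.
apply: (@le_trans _ _ (2%:E * H%:E + 2%:E * (H + (1 - m^-1) ^+ n * S0)%:E)%E).
  by rewrite leeD// lee_pmul2l//; exact: ltW.
rewrite -!EFinM -EFinD lee_fin; lra.
Qed.

End kaczmarz.

(** * Sums over a countable type *)

Section countable_sums.
Local Open Scope ereal_scope.
Context {R : realType} {J : countType}.
Implicit Types (a : J -> \bar R) (s : seq J).

(** By [csum_ge] and [csum_le] this is the supremum of the finite sums; written
    as a series, it commutes with integrals by monotone convergence. *)
Definition csum a : \bar R :=
  \sum_(0 <= n <oo) oapp a 0 (choice.pickle_inv n).

Let oapp_ge0 a n : (forall i, 0 <= a i) -> 0 <= oapp a 0 (choice.pickle_inv n : option J).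
Proof. by move=> a0; case: choice.pickle_inv => [i|] /=. Qed.

Lemma csum_ge a s : (forall i, 0 <= a i) -> uniq s -> \sum_(i <- s) a i <= csum a.
Proof.
move=> a0 us; pose k := (\max_(i <- s) (choice.pickle i).+1)%N.
apply: (@le_trans _ _ (\sum_(0 <= n < k) oapp a 0 (choice.pickle_inv n))); last first.
  by apply: nneseries_lim_ge => n _ _; exact: oapp_ge0.
have -> : \sum_(i <- s) a i = \sum_(n <- map choice.pickle s) oapp a 0 (choice.pickle_inv n).
  by rewrite big_map; apply: eq_bigr => i _; rewrite choice.pickleK_inv.
rewrite big_mkord -(big_mkord xpredT (fun n => oapp a 0 (choice.pickle_inv n))).
rewrite [leRHS](bigID (mem (map choice.pickle s)))/= -[leLHS]adde0; apply: leeD; last first.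
  by apply: sume_ge0 => n _; exact: oapp_ge0.
rewrite -[leRHS]big_filter (perm_big [seq n <- index_iota 0 k | n \in map choice.pickle s])//.
apply: uniq_perm; rewrite ?filter_uniq ?iota_uniq//.
  by rewrite map_inj_uniq//; exact: pcan_inj choice.pickleK_inv.
move=> n; rewrite mem_filter mem_index_iota /=.
apply/idP/andP => [ns|[]//]; split=> //.
have /mapP[i si ->] := ns.
by rewrite /k (big_rem i)//= leq_max leqnn.
Qed.

Lemma csum_le a M : (forall i, 0 <= a i) ->
  (forall s, uniq s -> \sum_(i <- s) a i <= M) -> csum a <= M.
Proof.
move=> a0 aM; apply: lime_le.
  by apply: is_cvg_nneseries => n _ _; exact: oapp_ge0.
apply: nearW => k.
have -> : \sum_(0 <= n < k) oapp a 0 (choice.pickle_inv n) =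
    \sum_(i <- pmap choice.pickle_inv (iota 0 k)) a i.
  rewrite /index_iota subn0; elim: (iota 0 k) => [|n t IH]; first by rewrite !big_nil.
  rewrite big_cons IH /=; case: choice.pickle_inv => [i|] /=; last by rewrite add0e.
  by rewrite big_cons.
apply: aM; apply: (pmap_uniq (g := choice.pickle)); last exact: iota_uniq.
exact: choice.pickle_invK.
Qed.

Context {d} {T : measurableType d} (mu : {measure set T -> \bar R}) (D : set T).
Hypothesis mD : measurable D.
Variable a : J -> T -> \bar R.
Hypothesis ma : forall i, measurable_fun D (a i).
Hypothesis a0 : forall i x, 0 <= a i x.

Let mo n : measurable_fun D (fun x => oapp (a ^~ x) 0 (choice.pickle_inv n)).
Proof. by case: choice.pickle_inv. Qed.

Lemma measurable_csum : measurable_fun D (fun x => csum (a ^~ x)).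
Proof.
apply: (ge0_emeasurable_sum (P := xpredT)
  (h := fun n x => oapp (a ^~ x) 0 (choice.pickle_inv n))) => // n x _ _.
exact: oapp_ge0.
Qed.

Lemma integral_csum :
  \int[mu]_(x in D) csum (a ^~ x) = csum (fun i => \int[mu]_(x in D) a i x).
Proof.
rewrite integral_nneseries//; last by move=> n x _; exact: oapp_ge0.
apply: eq_eseriesr => n _; case: choice.pickle_inv => [i|] //=.
exact: integral0.
Qed.

End countable_sums.

(** * The tensor basis of the cube *)

Section tensor_basis.
Context {R : realType} {d : nat}.
Variable phi : nat -> measurableTypeR R -> R.
Hypothesis hphi : orthonormal_basis lebesgue_measure (`[0, 1] : set R) phi.

Let U : set (measurableTypeR R) := (`[0, 1] : set R).

Let mU : measurable U. Proof. exact: measurable_itv. Qed.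

(** Cutting [phi] off outside the unit interval makes the tensor products
    globally measurable and supported in the cube. *)
Definition unit_phi (i : nat) : measurableTypeR R -> R := phi i \_ U.

Definition tensor_phi (k : 'I_d -> nat) (t : d.-tuple (measurableTypeR R)) : R :=
  \prod_a unit_phi (k a) (tnth t a).

Lemma unit_cubeP (t : d.-tuple (measurableTypeR R)) :
  unit_cube t <-> forall a, U (tnth t a).
Proof.
split=> [h a|h a]; first by rewrite /U/= in_itv/=; apply/andP; exact: h.
by have := h a; rewrite /U/= in_itv/= => /andP.
Qed.

Lemma measurable_unit_cube : measurable (@unit_cube R d).
Proof.
rewrite (_ : @unit_cube R d = \bigcap_(a in [set: 'I_d])
   ((fun t : d.-tuple (measurableTypeR R) => tnth t a) @^-1` U)).
  apply: fin_bigcap_measurable => // a _; rewrite -[_ @^-1` _]setTI.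
  exact: measurable_tnth.
apply/seteqP; split => t; first by move=> /unit_cubeP h a _; exact: h.
by move=> h; apply/unit_cubeP => a; exact: h.
Qed.

Lemma measurable_unit_phi i : measurable_fun setT (unit_phi i).
Proof.
have [+ _ _] := hphi => /(_ i)[mi _].
by rewrite /unit_phi; apply/(measurable_restrictT _ mU).
Qed.

Lemma measurable_tensor_phi k : measurable_fun setT (tensor_phi k).
Proof.
apply: (@measurable_tuple_prod R _ _ d (fun a => unit_phi (k a))) => a.
exact: measurable_unit_phi.
Qed.

Lemma unit_phi_orth i j :
  lebesgue_measure.-integrable setT (fun x => (unit_phi i x * unit_phi j x)%:E) /\
  (\int[lebesgue_measure]_x (unit_phi i x * unit_phi j x)%:E = ((i == j)%:R)%:E)%E.
Proof.
have [L2 orth _] := hphi.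
have int : lebesgue_measure.-integrable U (fun x => (phi i x * phi j x)%:E).
  have [mi si] := L2 i; have [mj sj] := L2 j.
  exact: integrable_mul_sq.
have E : (fun x => (unit_phi i x * unit_phi j x)%:E) =
    (fun x => (phi i x * phi j x)%:E) \_ U.
  apply/funext => x; rewrite /unit_phi /patch; case: ifP => // _.
  by rewrite mul0r.
rewrite E -integral_mkcond; split; first by rewrite -integrable_mkcond.
rewrite -(orth i j) /inner /Rintegral fineK//.
exact: (integrable_fin_num mU int).
Qed.

Lemma tensor_phi_orth (k k' : {ffun 'I_d -> nat}) :
  (\int[lebesgue_tuple d]_(t in @unit_cube R d) (tensor_phi k t * tensor_phi k' t)%:E
   = ((k == k')%:R)%:E)%E.
Proof.
rewrite integral_mkcond.
pose f a x := unit_phi (k a) x * unit_phi (k' a) x.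
have -> : (fun t => (tensor_phi k t * tensor_phi k' t)%:E) \_ (@unit_cube R d) =
    fun t => (\prod_a f a (tnth t a))%:E.
  apply/funext => t; rewrite /patch; case: ifPn => [_|tU].
    by rewrite /tensor_phi -big_split.
  have /existsNP[a ta] : ~ (forall a, U (tnth t a)).
    by move=> /unit_cubeP h; move/negP: tU; apply; rewrite inE.
  rewrite (bigD1 a)//= /f /unit_phi /patch ifF ?mul0r//.
  by apply/negbTE; rewrite notin_setE.
have [_ ->] := @integral_tuple_prod _ _ _ lebesgue_measure d f
  (fun a => (k a == k' a)%:R) (fun a => (unit_phi_orth _ _).1)
  (fun a => (unit_phi_orth _ _).2).
congr EFin; case: eqVneq => [->|kk'].
  by rewrite big1// => a _; rewrite eqxx.
have /existsP[a ka] : [exists a, k a != k' a].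
  apply: contraNT kk' => /existsPn h; apply/eqP/ffunP => a.
  by apply/eqP; rewrite -[_ == _]negbK h.
by rewrite (bigD1 a)//= (negbTE ka) mul0r.
Qed.

End tensor_basis.

Section index_extension.
Context {R : realType} {d b : nat}.

(** Multi-indices over different subsets of coordinates become comparable: equal
    extensions mean equal functions in the cube. *)
Definition extend (i : field_index d b) (a : 'I_d) : nat :=
  if insub a is Some a' then tagged i a' else 0%N.

Definition amplitude (lambda : nat -> R) (i : field_index d b) : R :=
  \prod_a lambda (tagged i a).

Lemma prod_extend (i : field_index d b) (f : nat -> 'I_d -> R) :
  (forall a, f 0%N a = 1) ->
  \prod_a f (extend i a) a = \prod_a f (tagged i a) (val a).
Proof.
move=> f0; rewrite (bigID (fun a => a \in val (tag i)))/=.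
rewrite [X in _ * X]big1 ?mulr1; last first.
  by move=> a ai; rewrite /extend insubF ?f0//; exact/negbTE.
rewrite big_sub; apply: eq_bigr => a _.
by rewrite /extend valK.
Qed.

End index_extension.

(** * Finite families of field indices and mean-square tails *)

Section index_boxes.
Context {R : realType} {d b : nat}.
Implicit Types (i j : field_index d b).

Lemma extend_inj i j : tag i = tag j -> extend i =1 extend j -> i = j.
Proof.
case: i j => A k [A' k'] /= AA'; subst A' => kk'; congr existT.
by apply/ffunP => a; have := kk' (val a); rewrite /extend valK.
Qed.

Definition box B i : {ffun 'I_d -> 'I_B.+1} := [ffun a => inord (extend i a)].

Lemma boxE B i : (forall a, extend i a <= B)%N ->
  (fun a => box B i a : nat) = extend i.
Proof. by move=> iB; apply/funext => a; rewrite ffunE inordK// ltnS. Qed.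

(** Together with [box], this presents the indices with bounded entries as pairs
    from a finite type. *)
Definition unbox B (A : bsubset d b) (k : {ffun 'I_d -> 'I_B.+1}) : field_index d b :=
  Tagged (fun A : bsubset d b => multi_index (val A))
    (finfun (fun a => k (val a) : nat) : multi_index (val A)).

Lemma boxK B i : (forall a, extend i a <= B)%N -> unbox B (tag i) (box B i) = i.
Proof.
move=> iB; apply: extend_inj => // a; rewrite -(boxE B i iB) /extend /=.
case: insubP => [a' _ <-|]; first by rewrite ffunE.
move=> aA; have := congr1 (@^~ a) (boxE B i iB); rewrite /= => ->.
by rewrite /extend insubN.
Qed.

(** Several field indices can have the same extension, but no two with the same
    coordinate subset; hence the number of subsets as a factor. *)
Lemma sum_extend_le B (h : ('I_d -> nat) -> R) (p : ('I_d -> nat) -> bool)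
    (G : seq (field_index d b)) :
  uniq G -> (forall k, 0 <= h k) ->
  (forall i, i \in G -> p (extend i) /\ forall a, (extend i a <= B)%N) ->
  \sum_(i <- G) h (extend i) <=
  #|{: bsubset d b}|%:R * \sum_(k : {ffun 'I_d -> 'I_B.+1} | p (fun a => k a))
     h (fun a => k a).
Proof.
move=> uG h0 hG; pose psi i := (tag i, box B i).
have psi_inj : {in G &, injective psi}.
  move=> i j /hG[_ iB] /hG[_ jB] [tij bij]; apply: extend_inj => // a.
  by rewrite -(boxE B i iB) -(boxE B j jB) bij.
have upsi : uniq (map psi G) by rewrite map_inj_in_uniq.
rewrite (eq_big_seq (fun i => h (fun a => (psi i).2 a))); last first.
  by move=> i /hG[_ iB]; rewrite /= boxE.
rewrite -(big_map psi xpredT (fun q => h (fun a => q.2 a))) big_uniq//=.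
rewrite mulr_natl -sumr_const pair_big_dep/=.
rewrite big_mkcond [leRHS]big_mkcond/=; apply: ler_sum => -[A k] _ /=.
case: ifPn => [/mapP[i /hG[pi iB] [_ ->]]|_]; last by case: ifP.
by rewrite boxE// pi.
Qed.

End index_boxes.

Section uncorrelated_series.
Context {R : realType} {J : choiceType} {dT} {T : measurableType dT}.
Variables (P : probability T R) (u : J -> T -> R).
Hypothesis mu : forall i, measurable_fun setT (u i).
Hypothesis orth : forall i j, (\int[P]_w (u i w * u j w)%:E = ((i == j)%:R)%:E)%E.

(** Compare with a partial sum over a larger finite set that is close to the
    limit: the terms in between are orthogonal.  The factor [2] of the
    inequality [(u + v)^2 <= 2 u^2 + 2 v^2] spares a limit argument for norms. *)
Lemma mean_square_tail (c : J -> R) (Y : T -> R) (F : {fset J}) (E0 : \bar R) :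
  measurable_fun setT Y ->
  ('E_P[fun w => ((Y w - \sum_(i <- G) c i * u i w) ^+ 2)%R]
    @[G --> summability.totally] --> 0)%E ->
  (forall G : seq J, uniq G -> {in G, forall i, i \notin F} ->
     ((\sum_(i <- G) c i ^+ 2)%:E <= E0)%E) ->
  (\int[P]_w ((Y w - \sum_(i <- F) c i * u i w) ^+ 2)%:E <= 2%:E * E0)%E.
Proof.
move=> mY cvgY tail; apply/lee_addgt0Pr => eps eps0.
have e4 : 0 < eps / 2 by rewrite divr_gt0.
have [] := cvgY [set x | (x < (eps / 2)%:E)%E].
  by apply: open_nbhs_nbhs; split; [exact: open_ereal_lt_ereal|rewrite /= lte_fin].
move=> F0 _ F0P; pose G := (F0 `|` F)%fset.
have FG : {subset F <= G} by move=> i iF; rewrite in_fsetU iF orbT.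
have := F0P G (fsubsetUl _ _); rewrite /= expectation.unlock => EG.
pose S (s : seq J) w := \sum_(i <- s) c i * u i w.
have mS s : measurable_fun setT (S s).
  by apply: measurable_sum => i; exact: measurable_funM.
pose N := [seq i <- G | i \notin F].
have SE w : S G w = S F w + S N w.
  rewrite /S (bigID (mem F))/= big_filter; congr (_ + _).
  rewrite -big_filter; apply: perm_big; apply: uniq_perm; rewrite ?filter_uniq ?fset_uniq//.
  move=> i; rewrite mem_filter/=. case: (boolP (i \in F)) => [iF|]; rewrite ?(FG _ iF)//.
have msq (v : T -> R) : measurable_fun setT v -> measurable_fun setT (fun w => (v w ^+ 2)%:E).
  by move=> mv; apply/measurable_EFinP; exact: measurable_funX.
have mYG : measurable_fun setT (fun w => Y w - S G w) by exact: measurable_funB.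
have sq0 (v : T -> R) w : setT w -> (0 <= (v w ^+ 2)%:E)%E by rewrite lee_fin sqr_ge0.
apply: (@le_trans _ _ (\int[P]_w (2%:E * ((Y w - S G w) ^+ 2)%:E
     + 2%:E * (S N w ^+ 2)%:E))%E).
  apply: ge0_le_integral => //.
  - by move=> w _; rewrite lee_fin sqr_ge0.
  - by apply: msq; exact: (measurable_funB mY (mS F)).
  - by apply: emeasurable_funD; apply: measurable_funeM; exact: msq.
  - move=> w _; rewrite -!EFinM -EFinD lee_fin -/(S F w) SE.
    move: (Y w) (S F w) (S N w) => y f n.
    have := sqr_ge0 ((y - f - n) - n); rewrite !sqrrB; lra.
rewrite ge0_integralD//; try (by move=> w _; rewrite mule_ge0// lee_fin sqr_ge0);
  try (by apply: measurable_funeM; exact: msq).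
rewrite !ge0_integralZl//; try (by move=> w _; rewrite lee_fin sqr_ge0);
  try (exact: msq).
rewrite addeC; apply: leeD.
  rewrite lee_pmul2l// integral_orthonormal_sum//.
    by apply: tail => [|i]; rewrite ?filter_uniq ?fset_uniq// mem_filter => /andP[].
  by rewrite filter_uniq ?fset_uniq.
have -> : eps%:E = (2%:E * (eps / 2)%:E)%E by rewrite -EFinM mulrC divfK.
by rewrite lee_pmul2l// ltW.
Qed.

End uncorrelated_series.

(** * Sampling the additive field *)

Section field.
Context {R : realType} (d b : nat).
Variable phi : nat -> measurableTypeR R -> R.
Hypothesis hphi : orthonormal_basis lebesgue_measure (`[0, 1] : set R) phi.
Hypothesis hphi0 : forall u : R, 0 <= u <= 1 -> phi 0%N u = 1.
Variable lambda : nat -> R.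
Hypothesis hlambda : forall i, 0 <= lambda i.

Notation D := (@unit_cube R d).
Notation tphi := (@tensor_phi R d phi).

Lemma tensor_phi0 t : D t -> tphi (fun=> 0%N) t = 1.
Proof.
move=> Dt; rewrite /tensor_phi big1// => a _; rewrite /unit_phi /patch mem_set.
  exact: hphi0 (introT andP (Dt a)).
by move/unit_cubeP : Dt; exact.
Qed.

Lemma field_coefE (i : field_index d b) t : D t ->
  field_coef lambda phi i t = amplitude lambda i * tphi (extend i) t.
Proof.
move=> Dt; rewrite /field_coef /tensor_phi; congr (_ * _).
have Ut a : tnth t a \in `[0, 1]%classic.
  by rewrite mem_set//; move/unit_cubeP : Dt; exact.
rewrite (prod_extend i (fun n a => unit_phi phi n (tnth t a))); last first.
  by move=> a; rewrite /unit_phi /patch Ut; exact: hphi0 (introT andP (Dt a)).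
by apply: eq_bigr => a _; rewrite /unit_phi /patch Ut.
Qed.

Lemma amplitude_sq_le (s r C0 : R) (i : field_index d b) : 0 < C0 ->
  (forall n, lambda n <= C0 * weight s n `^ r) ->
  amplitude lambda i ^+ 2 <=
    C0 ^+ (b + b) * \prod_a weight s (extend i a) `^ (2 * r).
Proof.
move=> C00 lw; have w0 n : 0 <= weight s n by exact/ltW/weight_gt0.
have -> : \prod_a weight s (extend i a) `^ (2 * r) =
   (\prod_a weight s (tagged i a) `^ r) ^+ 2.
  rewrite (prod_extend i (fun n _ => weight s n `^ (2 * r))); last first.
    by move=> a; rewrite weight0 powR1.
  rewrite expr2 -big_split/=; apply: eq_bigr => a _.
  by rewrite -powRD ?(gt_eqF (weight_gt0 _ _)) ?implybT// mulr_natl mulr2n.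
rewrite exprD -expr2 -exprMn lerXn2r ?nnegrE//.
- by apply: prodr_ge0 => a _.
- rewrite mulr_ge0 ?exprn_ge0 ?(ltW C00)// prodr_ge0// => a _; exact: powR_ge0.
have -> : C0 ^+ b = \prod_(a : {a : 'I_d | a \in val (tag i)}) C0.
  rewrite prodr_const; congr (_ ^+ _).
  by rewrite card_sig; have /eqP := valP (tag i).
by rewrite -big_split/=; apply: ler_prod => a _; rewrite hlambda lw.
Qed.

Context {dT} {T : measurableType dT} (P : probability T R).
Variable xi : field_index d b -> {RV P >-> R}.
Hypothesis hmean : forall i, ('E_P[xi i] = 0)%E.
Hypothesis hvar : forall i, ('V_P[xi i] = 1)%E.
Hypothesis huncor : forall i j, i <> j -> covariance P (xi i) (xi j) = 0%E.

Lemma xi_orth i j : (\int[P]_w (xi i w * xi j w)%:E = ((i == j)%:R)%:E)%E.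
Proof.
have -> : (\int[P]_w (xi i w * xi j w)%:E = covariance P (xi i) (xi j))%E.
  rewrite covariance.unlock !hmean expectation.unlock; apply: eq_integral => w _.
  by rewrite -[RHS]/(((xi i w - 0) * (xi j w - 0))%:E) !subr0.
have [->|/eqP ij] := eqVneq i j; last by rewrite huncor.
exact: hvar.
Qed.

Variable X : d.-tuple (measurableTypeR R) -> T -> R.
Hypothesis hXmeas : measurable_fun ([set: T] `*` D)
  (fun wt : T * d.-tuple (measurableTypeR R) => X wt.2 wt.1).
Hypothesis hX : forall t, unit_cube t ->
  mean_square_series P lambda phi xi t (X t).

Lemma measurable_field t : D t -> measurable_fun setT (X t).
Proof.
move=> Dt.
have mpair : measurable_fun setT (fun w : T => (w, t)).
  exact: (measurable_fun_pair (f := id) (g := cst t)).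
have mTD := measurableX (T1 := T) measurableT (@measurable_unit_cube R d).
by apply: (measurable_comp mTD _ hXmeas mpair) => _ [w _ <-].
Qed.

Variables (s r C0 M tail S m1 : R).
Hypothesis (s1 : 1 < s) (C00 : 0 < C0) (M1 : 1 <= M) (tail0 : 0 < tail).
Hypothesis (d0 : (0 < d)%N) (m10 : 0 < m1).
Hypothesis lambda_le : forall n, lambda n <= C0 * weight s n `^ r.
Hypothesis tail_le : forall B, \sum_(k : {ffun 'I_d -> 'I_B.+1} |
  ~~ in_cross s M (fun a => k a)) \prod_a weight s (k a) `^ (2 * r) <= tail.
Hypothesis total_le : forall B, \sum_(k : {ffun 'I_d -> 'I_B.+1})
  \prod_a weight s (k a) `^ (2 * r) <= S.
Hypothesis card_le : forall B,
  (#|[pred k : {ffun 'I_d -> 'I_B.+1} | in_cross s M (fun a => k a)]|)%:R <= m1.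

Let K : R := #|{: bsubset d b}|.+1%:R * C0 ^+ (b + b).
Let K0 : 0 < K. Proof. by rewrite mulr_gt0 ?ltr0n ?exprn_gt0. Qed.

Let s0 : 0 <= s. Proof. exact: le_trans ler01 (ltW s1). Qed.

Notation amp := (@amplitude R d b lambda).
Notation ext := (@extend d b).

(** Reduction of sums of squared coefficients over finite families of field
    indices to sums of weights over boxes. *)
Lemma sum_amplitude_le (p : ('I_d -> nat) -> bool) (V : R) (G : seq (field_index d b)) :
  (forall B, \sum_(k : {ffun 'I_d -> 'I_B.+1} | p (fun a => k a))
     \prod_a weight s (k a) `^ (2 * r) <= V) ->
  uniq G -> (forall i, i \in G -> p (ext i)) ->
  \sum_(i <- G) amp i ^+ 2 <= K * V.
Proof.
move=> pV uG Gp.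
pose wt (k : 'I_d -> nat) : R := \prod_a weight s (k a) `^ (2 * r).
have wt0 k : 0 <= wt k by apply: prodr_ge0 => a _; exact: powR_ge0.
have V0 : 0 <= V by apply: le_trans (pV 0%N); apply: sumr_ge0 => k _; exact: wt0.
pose B := (\max_(i <- G) \max_a ext i a)%N.
have GB i : i \in G -> forall a, (ext i a <= B)%N.
  move=> iG a; rewrite /B (big_rem i)//= leq_max; apply/orP; left.
  exact: (leq_bigmax a).
apply: (@le_trans _ _ (\sum_(i <- G) C0 ^+ (b + b) * wt (ext i))).
  by apply: ler_sum => i _; exact: amplitude_sq_le.
rewrite -mulr_sumr.
rewrite [leRHS](_ : _ = C0 ^+ (b + b) * (#|{: bsubset d b}|.+1%:R * V)); last first.
  by rewrite /K; ring.
rewrite ler_pM2l ?exprn_gt0//.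
apply: le_trans (sum_extend_le B wt p G uG wt0 _) _; first by move=> i iG; split; auto.
apply: (@le_trans _ _ (#|{: bsubset d b}|%:R * V)); first by rewrite ler_wpM2l// pV.
by rewrite ler_wpM2r// ler_nat.
Qed.

Let B := Num.bound M.

Let cross_le i : in_cross s M (ext i) -> forall a, (ext i a <= B)%N.
Proof.
move=> iM a; have := in_cross_bounded s M _ s0 iM a.
have := archi_boundP (le_trans ler01 M1); rewrite -/B => MB h.
by have := le_lt_trans h MB; rewrite ltr_nat => /ltnW/ltnW.
Qed.

Let F : {fset field_index d b} :=
  [fset i in [seq unbox B q.1 q.2 | q <- enum {: bsubset d b * {ffun 'I_d -> 'I_B.+1}}]
    | in_cross s M (ext i)]%fset.

Let memF i : (i \in F) = in_cross s M (ext i).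
Proof.
rewrite !inE /=; apply: andb_idl => iM.
apply/mapP; exists (tag i, box B i); first by rewrite mem_enum.
by rewrite /= boxK//; exact: cross_le.
Qed.

Let I := {k : {ffun 'I_d -> 'I_B.+1} | in_cross s M (fun a => k a)}.

Let e (k : I) : d.-tuple (measurableTypeR R) -> R := tphi (fun a => val k a).

Let me k : measurable_fun setT (e k).
Proof. exact: measurable_tensor_phi. Qed.

Let eorth (k k' : I) :
  (\int[lebesgue_tuple d]_(t in D) (e k t * e k' t)%:E = ((k == k')%:R)%:E)%E.
Proof.
pose f (k : I) : {ffun 'I_d -> nat} := [ffun a => (val k a : nat)].
have ef l : e l = tphi (f l) by congr tphi; apply/funext => a; rewrite ffunE.
rewrite !ef tensor_phi_orth//; congr ((_ _)%:R%:E).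
apply/eqP/eqP => [/ffunP fk|->//].
apply/val_inj/ffunP => a; apply/val_inj; have := fk a; by rewrite !ffunE.
Qed.

Let k0 : I.
Proof.
exists [ffun=> ord0]; rewrite (_ : (fun _ => _) = (fun=> 0%N)) ?in_cross0//.
by apply/funext => a; rewrite ffunE.
Defined.

Let e_gt0 t : D t -> 0 < \sum_k e k t ^+ 2.
Proof.
move=> Dt; rewrite (bigD1 k0)//= ltr_pwDl//; last first.
  by apply: sumr_ge0 => k _; exact: sqr_ge0.
rewrite /e (_ : (fun _ => _) = (fun=> 0%N)) ?tensor_phi0 ?expr1n//.
by apply/funext => a; rewrite ffunE.
Qed.

(** The coefficients, in the tensor basis, of the part of the field carried by
    the cross: all terms with the same extension are collected. *)
Let sc (k : I) (w : T) : R := \sum_(i <- F | box B i == val k) amp i * xi i w.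

Let msc k : measurable_fun setT (sc k).
Proof.
rewrite /sc; under eq_fun do rewrite -big_filter.
by apply: measurable_sum => i; exact: measurable_funM.
Qed.

Let sum_sc (f : I -> R) (g : ('I_d -> nat) -> R) (h : field_index d b -> R) :
  (forall k : I, f k = g (fun a => val k a)) ->
  \sum_k (\sum_(i <- F | box B i == val k) h i) * f k =
  \sum_(i <- F) h i * g (ext i).
Proof.
move=> fg; under eq_bigr => k _ do rewrite mulr_suml big_mkcond/=.
rewrite exchange_big/=; apply: eq_big_seq => i; rewrite memF => iM.
have bi : (fun a => box B i a : nat) = ext i by apply: boxE; exact: cross_le.
have biM : in_cross s M (fun a => box B i a) by rewrite bi.
rewrite (bigD1 (exist _ (box B i) biM : I))//= eqxx fg/= bi big1 ?addr0// => k ki.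
by case: eqP => // bk; case/eqP: ki; exact: val_inj.
Qed.

Let partialE t w : D t ->
  \sum_k sc k w * e k t = \sum_(i <- F) field_coef lambda phi i t * xi i w.
Proof.
move=> Dt; rewrite (sum_sc (e ^~ t) (tphi ^~ t))//.
by apply: eq_bigr => i _; rewrite field_coefE// mulrAC.
Qed.

Let sc_le : (\int[P]_w (\sum_k sc k w ^+ 2)%:E <= (K * S)%:E)%E.
Proof.
under eq_integral do rewrite -sumEFin.
rewrite ge0_integral_sum//; first last.
- by move=> k w _; rewrite lee_fin sqr_ge0.
- by move=> k; apply/measurable_EFinP; exact: measurable_funX.
under eq_bigr => k _.
  rewrite /sc; under eq_integral do rewrite -big_filter.
  rewrite integral_orthonormal_sum ?filter_uniq ?fset_uniq//; last exact: xi_orth.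
  rewrite big_filter; over.
rewrite sumEFin lee_fin.
rewrite (_ : \sum_(k : I) _ = \sum_(i <- F) amp i ^+ 2); last first.
  transitivity (\sum_(k : I) (\sum_(i <- F | box B i == val k) amp i ^+ 2) * 1).
    by apply: eq_bigr => k _; rewrite mulr1.
  rewrite (sum_sc (fun=> 1) (fun=> 1) (fun i => amp i ^+ 2) (fun=> erefl)).
  by apply: eq_bigr => i _; exact: mulr1.
by apply: (sum_amplitude_le xpredT) => //; exact: fset_uniq.
Qed.

Let cterm (i : field_index d b) t : R := if i \in F then 0 else (amp i * tphi (ext i) t) ^+ 2.

(** The tail of the variance at [t], with the factor of [mean_square_tail]. *)
Let eta t : \bar R := (2%:E * csum (fun i => (cterm i t)%:E))%E.

Let cterm0 i t : (0 <= (cterm i t)%:E)%E.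
Proof. by rewrite lee_fin /cterm; case: ifP => // _; exact: sqr_ge0. Qed.

Let mcterm i : measurable_fun D (fun t => (cterm i t)%:E).
Proof.
apply/measurable_EFinP; rewrite /cterm; case: (i \in F) => //.
apply: measurable_funX; apply: measurable_funM => //.
by apply: measurable_funTS; exact: measurable_tensor_phi.
Qed.

Let meta : measurable_fun D eta.
Proof. by apply: measurable_funeM; exact: measurable_csum. Qed.

Let X_near t : D t ->
  (\int[P]_w ((X t w - \sum_k sc k w * e k t) ^+ 2)%:E <= eta t)%E.
Proof.
move=> Dt; under eq_integral do rewrite partialE//.
apply: (mean_square_tail P xi _ xi_orth (fun i => field_coef lambda phi i t)) => //.
- exact: measurable_field.
- exact: hX.
move=> G uG GF; apply: le_trans (csum_ge _ G _ uG) => //.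
rewrite -sumEFin le_eqVlt; apply/orP; left; apply/eqP; apply: eq_big_seq => i iG.
by rewrite /cterm (negbTE (GF i iG)) field_coefE.
Qed.

Let etaH : (\int[lebesgue_tuple d]_(t in D) eta t < (4 * (K * tail))%:E)%E.
Proof.
have mD := @measurable_unit_cube R d.
rewrite /eta ge0_integralZl//; first last.
- by move=> t _; apply: le_trans (csum_ge _ [::] _ _); rewrite ?big_nil.
- exact: measurable_csum.
rewrite integral_csum//.
apply: (@le_lt_trans _ _ (2%:E * (K * tail)%:E)%E).
  rewrite lee_pmul2l//; apply: csum_le.
    by move=> i; apply: integral_ge0.
  move=> G uG.
  pose q (k : 'I_d -> nat) := ~~ in_cross s M k.
  apply: (@le_trans _ _ (\sum_(i <- [seq i <- G | q (ext i)]) amp i ^+ 2)%:E).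
    rewrite big_filter -sumEFin [leRHS]big_mkcond/=.
    apply: lee_sum => i _; rewrite /q -memF /cterm; case: (i \in F) => /=.
      by rewrite integral0_eq.
    under eq_integral do rewrite exprMn EFinM.
    rewrite ge0_integralZl_EFin ?sqr_ge0//; last 2 first.
    - by move=> t _; rewrite lee_fin sqr_ge0.
    - apply/measurable_EFinP; apply: measurable_funX; apply: measurable_funTS.
      exact: measurable_tensor_phi.
    under eq_integral do rewrite expr2.
    pose k : {ffun 'I_d -> nat} := [ffun a => ext i a].
    have -> : ext i = k by apply/funext => a; rewrite ffunE.
    by rewrite tensor_phi_orth// eqxx mule1.
  rewrite lee_fin; apply: (sum_amplitude_le q); rewrite ?filter_uniq//.
  by move=> i; rewrite mem_filter => /andP[].
have Kt : 0 < K * tail by exact: mulr_gt0.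
rewrite -EFinM lte_fin; move: (K * tail) Kt => v v0; lra.
Qed.

(** The Kaczmarz bound for the part of the field carried by a cross.  The
    factor [16] is [4] times the strict bound [etaH] on the tail. *)
Lemma field_algorithm (n : nat) :
  exists A : sampling_algorithm R d n,
   (\int[P]_w sqnorm2 (lebesgue_tuple d) D
       (fun t => (X t w - run_algorithm A (X ^~ w) t)%R)
    <= (16 * (K * tail) + 2 * ((1 - m1^-1) ^+ n * (K * S)))%:E)%E.
Proof.
have mD := @measurable_unit_cube R d.
pose m : R := #|{: I}|%:R.
have m_ge1 : 1 <= m by rewrite ler1n; apply/card_gt0P; exists k0.
have m_gt0 : 0 < m by rewrite (lt_le_trans _ m_ge1).
have mm1 : m <= m1.
  apply: le_trans (card_le B); rewrite ler_nat card_sig; apply: subset_leq_card.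
  apply/fintype.subsetP => k; rewrite !inE.
  exact.
pose t0 : d.-tuple (measurableTypeR R) := [tuple (0 : R) | i < d].
have Dt0 : D t0 by move=> a; rewrite tnth_mktuple lexx ler01.
have [tau [c [Dtau err]]] := kaczmarz_error P (lebesgue_tuple d) D mD e
  (fun k => measurable_funTS (me k)) eorth e_gt0 X measurable_field sc msc
  eta _ meta X_near etaH m erefl m_gt0 hXmeas (K * S) t0 n Dt0 m_ge1 sc_le.
have wL2 l : inL2 (lebesgue_tuple d) D (fun t => \sum_k c l k * e k t).
  split.
    apply: measurable_sum => k; apply: measurable_funM => //.
    exact: measurable_funTS.
  rewrite /sqnorm2 integral_orthonormal_sum ?ltry ?index_enum_uniq//.
  by move=> k; exact: measurable_funTS.
exists (@SamplingAlgorithm R d n (fun l => tau l) (fun l t => \sum_k c l k * e k t)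
  (fun l => Dtau l) (fun l => wL2 l)).
rewrite /sqnorm2 /run_algorithm /=; apply: le_trans err _.
rewrite lee_fin lerD//; first by lra.
rewrite ler_pM2l// ler_wpM2r//.
  by rewrite -lee_fin; apply: le_trans sc_le; apply: integral_ge0 => w _;
     rewrite lee_fin sumr_ge0// => k _; rewrite sqr_ge0.
apply: lerXn2r; rewrite ?nnegrE ?subr_ge0 ?invf_le1 ?(lt_le_trans m_gt0 mm1)//.
  by rewrite (le_trans m_ge1).
by rewrite lerD2l lerN2 lef_pV2 ?posrE.
Qed.

End field.

(** * Rates *)

Section rates.
Context {R : realType}.
Implicit Types (x e p s r q c : R).

Lemma ln_le_powR {e x} : 0 < e -> 0 < x -> ln x <= e * x `^ (e^-1).
Proof.
move=> e0 x0; have := ltW (ln_sublinear (powR_gt0 e^-1 x0)).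
by rewrite ln_powR ler_pdivrMl.
Qed.

Lemma weight_powR s r i :
  weight s i `^ r = i.+1%:R `^ (- r) * loglen i `^ (- (s * r)) :> R.
Proof.
rewrite /weight -powR_inv1 ?mulr_ge0 ?powR_ge0// -powRrM mulN1r.
by rewrite powRM ?powR_ge0 ?ler0n// -powRrM mulrN.
Qed.

Lemma sum_weight_prod {d s p} : 1 < s -> 1 < p -> exists2 S : R, 0 < S & forall B,
  \sum_(k : {ffun 'I_d -> 'I_B.+1}) \prod_a weight s (k a) `^ p <= S.
Proof.
move=> s1 p1; have [W W1 sumW] := @sum_weight R s s1.
have s0 : 0 <= s by lra.
exists (W ^+ d); first by rewrite exprn_gt0// (lt_le_trans _ W1).
move=> B; rewrite -(bigA_distr_bigA (fun (a : 'I_d) (x : 'I_B.+1) => weight s x `^ p)).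
have -> : W ^+ d = \prod_(a < d) W by rewrite prodr_const card_ord.
apply: ler_prod => a _; rewrite sumr_ge0/=; last by move=> i _; exact: powR_ge0.
apply: le_trans (sumW B.+1); apply: ler_sum => i _.
by rewrite ge1r_powR ?weight_gt0 ?weight_le1// ltW.
Qed.

(** Far out, [lambda] is at most twice its asymptotic form; the finitely many
    initial terms are absorbed in the constant. *)
Lemma asymptotic_weight {lambda : nat -> R} {mu r q} :
  (forall i, 0 <= lambda i) -> 0 < mu -> 0 < r -> q < 0 ->
  lambda ~_\oo (fun i : nat => mu * i%:R `^ (- r) * (ln i%:R) `^ q) ->
  exists2 C, 0 < C & forall i, lambda i <= C * weight (- q / r) i `^ r.
Proof.
move=> l0 mu0 r0 q0 /eqaddoP/(_ 1 ltr01)[N _ NP].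
have wE i : weight (- q / r) i `^ r = i.+1%:R `^ (- r) * loglen i `^ q :> R.
  by rewrite weight_powR divfK ?gt_eqF// opprK.
have w0 i : 0 < weight (- q / r) i `^ r :> R by rewrite powR_gt0// weight_gt0.
have ln2 : 0 < ln 2 :> R by rewrite ln_gt0// ltr1n.
pose k : R := ((ln 2)^-1 + 2)^-1.
have k0 : 0 < k by rewrite invr_gt0 addr_gt0// invr_gt0.
have lnk i : (2 <= i)%N -> k * loglen i <= ln i%:R :> R.
  move=> i2; rewrite mulrC ler_pdivrMr ?addr_gt0 ?invr_gt0// /loglen mulrDr.
  apply: lerD.
    by rewrite ler_pdivlMr// mul1r ler_ln ?posrE ?ltr0n ?(leq_trans _ i2)// ler_nat.
  rewrite mulr_natr -lnXn ?ltr0n ?(leq_trans _ i2)//.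
  rewrite ler_ln ?posrE ?exprn_gt0 ?ltr0n ?(leq_trans _ i2)//.
  rewrite -natrX ler_nat; case: i i2 => [|[|i]]// _.
  apply: (@leq_trans (i.+2 * 2)); last by rewrite -mulnn leq_mul.
  by rewrite muln2 -addnn addnS ltnS leq_addr.
pose N' := maxn N 2.
have big i : (N' <= i)%N -> lambda i <= 2 * mu * 2 `^ r * k `^ q * weight (- q / r) i `^ r.
  rewrite geq_max => /andP[/NP /= h i2].
  set g := mu * _ * _ in h.
  have i0 : 0 < i%:R :> R by rewrite ltr0n (leq_trans _ i2).
  have g0 : 0 <= g by rewrite !mulr_ge0 ?powR_ge0// ltW.
  have {}h : lambda i <= 2 * g.
    move: h; rewrite mul1r (ger0_norm g0) ler_norml => /andP[_].
    rewrite -[X in X <= _]/(lambda i - g); lra.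
  apply: le_trans h _; rewrite -!mulrA ler_pM2l// /g -!mulrA ler_pM2l// wE.
  rewrite [leRHS](_ : _ = (2 `^ r * i.+1%:R `^ (- r)) * (k `^ q * loglen i `^ q)); last by ring.
  apply: ler_pM; rewrite ?powR_ge0//.
    rewrite -ler_pdivrMl ?powR_gt0// -powRN -powRM ?ler0n//.
    apply: powR_le_neg; rewrite ?ltr0n ?(ltW r0)//.
    by rewrite -natrM ler_nat mul2n -addnn -addn1 leq_add2l (leq_trans _ i2).
  rewrite -powRM ?(ltW k0) ?(ltW (loglen_gt0 _))// -(opprK q).
  apply: powR_le_neg; rewrite ?mulr_gt0 ?loglen_gt0// ?lnk//; lra.
pose C := 2 * mu * 2 `^ r * k `^ q + \sum_(i < N') lambda i / weight (- q / r) i `^ r.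
have sum0 : 0 <= \sum_(i < N') lambda i / weight (- q / r) i `^ r.
  by apply: sumr_ge0 => i _; rewrite divr_ge0// ltW.
have c0 : 0 < 2 * mu * 2 `^ r * k `^ q by rewrite !mulr_gt0 ?powR_gt0.
exists C; first by rewrite ltr_pwDl.
move=> i; have [iN|iN] := leqP N' i.
  by rewrite (le_trans (big i iN))// ler_pM2r// lerDl.
rewrite -ler_pdivrMr// /C (bigD1 (Ordinal iN))//= addrCA lerDl.
apply: addr_ge0; first exact: ltW.
by apply: sumr_ge0 => j _; rewrite divr_ge0// ltW.
Qed.

Section cross_size.
Variables (r c : R) (n : nat).
Hypothesis (r12 : 1 / 2 < r) (c1 : 1 <= c) (n2 : (2 <= n)%N).
Let r1 : 1 < 2 * r. Proof. by move: r12; rewrite ltr_pdivrMr// mulrC. Qed.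
Let r0 : 0 < r. Proof. by rewrite (lt_trans _ r12). Qed.
Let c0 : 0 < c. Proof. exact: lt_le_trans c1. Qed.

Let c' := 2 * r * c.
Let L : R := ln n%:R.
Let y := n%:R / (c' * L).

(** A cross of this size has at most [c * cross_size] elements, so [n] steps
    contract by about [exp (- n / (c n / (2 r c ln n))) = n^(- 2 r)].  Adding [1]
    keeps the size at least [1] and costs a constant factor only, since
    [(ln n)^2 <= 4 n]. *)
Definition cross_size : R := 1 + y.

Let L0 : 0 < L. Proof. by rewrite ln_gt0// ltr1n. Qed.
Let n0 : 0 < n%:R :> R. Proof. by rewrite ltr0n (leq_trans _ n2). Qed.
Let c'1 : 1 < c'.
Proof. by rewrite (lt_le_trans r1)// ler_peMr// ltW// (lt_trans ltr01). Qed.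
Let c'0 : 0 < c'. Proof. exact: lt_trans c'1. Qed.
Let ln2c'_ge0 : 0 <= ln (2 * c').
Proof. by rewrite ln_ge0// (le_trans (ltW c'1))// ler_peMl ?ler1n// ltW. Qed.
Let y0 : 0 < y. Proof. by rewrite divr_gt0// mulr_gt0. Qed.
Let yM : y <= cross_size. Proof. by rewrite lerDr. Qed.
Let M1 : 1 <= cross_size. Proof. by rewrite lerDl ltW. Qed.
Let M0 : 0 < cross_size. Proof. exact: lt_le_trans M1. Qed.

Let nE : n%:R = c' * L * y.
Proof. by rewrite /y mulrC divfK// gt_eqF// mulr_gt0. Qed.

Let L2 : L ^+ 2 <= 4 * n%:R.
Proof.
have h := @ln_le_powR 2 n%:R (ltr0Sn R 1) n0.
have -> : 4 * n%:R = (2 * n%:R `^ (2^-1)) ^+ 2 :> R.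
  rewrite exprMn -[X in _ = _ * X]powR_mulrn ?powR_ge0// -powRrM mulVf// powRr1 ?ltW//.
  by ring.
by rewrite lerXn2r// nnegrE ?mulr_ge0 ?powR_ge0// ltW.
Qed.

Lemma exp_decay : (1 - (c * cross_size)^-1) ^+ n <= expR (8 * r * c') * n%:R `^ (- (2 * r)).
Proof.
have cM1 : 1 <= c * cross_size by rewrite (le_trans c1)// ler_peMr// ltW.
have cM0 := lt_le_trans ltr01 cM1.
set u := (c * cross_size)^-1.
have h := expR_ge1Dx (- u).
apply: (@le_trans _ _ (expR (- u) ^+ n)).
  rewrite lerXn2r// nnegrE ?expR_ge0// subr_ge0 invf_le1//.
rewrite -expRM_natl /powR gt_eqF// -expRD ler_expR -/L.
have Ly : L <= 4 * c' * cross_size.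
  rewrite -(ler_pM2l L0) -expr2 (le_trans L2)// nE.
  rewrite [leRHS](_ : _ = 4 * (c' * L * cross_size)); last by ring.
  by rewrite !ler_pM2l// mulr_gt0.
have -> : n%:R * - u = - (2 * r * L) + 2 * r * L / cross_size.
  rewrite nE /u /cross_size /c'; field; rewrite !gt_eqF//.
rewrite mulNr addrC lerD2r ler_pdivrMr//.
rewrite [leRHS](_ : _ = 2 * r * (4 * c' * cross_size)); last by ring.
by rewrite ler_pM2l// mulr_gt0.
Qed.

(** As [ln n <= 2 sqrt n], the size exceeds a multiple of [sqrt n]; so passing
    from [n] to the size of the cross does not change the order of logarithms. *)
Lemma loglen_cross_size : L / (2 * (1 + ln (2 * c'))) <= 1 + ln cross_size.
Proof.
have b0 := ln2c'_ge0.
have lM : 0 <= ln cross_size by rewrite ln_ge0.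
have nM : n%:R <= (2 * c' * cross_size) ^+ 2.
  rewrite -(ler_pM2l n0).
  apply: (@le_trans _ _ ((c' * L * cross_size) ^+ 2)).
    rewrite -expr2 lerXn2r// ?nnegrE ?ltW ?mulr_gt0// {1}nE.
    by rewrite ltr_pM2l ?mulr_gt0// ltrDr.
  rewrite [leLHS](_ : _ = L ^+ 2 * (c' * cross_size) ^+ 2); last by ring.
  rewrite [leRHS](_ : _ = 4 * n%:R * (c' * cross_size) ^+ 2); last by ring.
  by rewrite ler_wpM2r// sqr_ge0.
have : L <= 2 * (ln (2 * c') + ln cross_size).
  rewrite -lnM ?posrE ?mulr_gt0// mulr_natl -lnXn ?mulr_gt0//.
  by rewrite ler_ln ?posrE ?exprn_gt0 ?mulr_gt0.
rewrite ler_pdivrMr; last by rewrite mulr_gt0// ltr_pwDl.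
move: (ln (2 * c')) (ln cross_size) b0 lM => u v u0 v0 h.
have := mulr_ge0 u0 v0; lra.
Qed.

Lemma tail_rate q : q < 0 ->
  cross_size `^ (1 - 2 * r) * (1 + ln cross_size) `^ (2 * q) <=
  c' `^ (2 * r - 1) * (2 * (1 + ln (2 * c')))^-1 `^ (2 * q) *
    (n%:R `^ (1 - 2 * r) * L `^ (2 * (q + r) - 1)).
Proof.
move=> q0; set k := (2 * (1 + _))^-1.
have b0 := ln2c'_ge0.
have k0 : 0 < k by rewrite invr_gt0 mulr_gt0// ltr_pwDl.
have r2 : 1 - 2 * r = - (2 * r - 1) by ring.
have q2 : 2 * q = - (- (2 * q)) by ring.
have h1 : cross_size `^ (1 - 2 * r) <= n%:R `^ (1 - 2 * r) * (c' * L) `^ (2 * r - 1).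
  rewrite r2; apply: le_trans (powR_le_neg y0 yM _) _; first by rewrite subr_ge0 ltW.
  have cL0 : 0 <= c' * L by rewrite mulr_ge0// ltW.
  rewrite /y [leLHS]powRM ?invr_ge0 ?(ltW n0)//.
  by rewrite -[(c' * L)^-1]powR_inv1// -powRrM mulN1r opprK.
have h2 : (1 + ln cross_size) `^ (2 * q) <= (k * L) `^ (2 * q).
  rewrite q2; apply: powR_le_neg; rewrite ?mulr_gt0//; last by lra.
  by rewrite mulrC; exact: loglen_cross_size.
apply: le_trans (ler_pM (powR_ge0 _ _) (powR_ge0 _ _) h1 h2) _.
rewrite (powRM (2 * r - 1) (ltW c'0) (ltW L0)) (powRM (2 * q) (ltW k0) (ltW L0)).
have -> : L `^ (2 * (q + r) - 1) = L `^ (2 * r - 1) * L `^ (2 * q).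
  by rewrite -powRD ?(gt_eqF L0) ?implybT//; congr (_ `^ _); ring.
by rewrite le_eqVlt; apply/orP; left; apply/eqP; ring.
Qed.

(** The geometric factor has the spare power [1 / n], which beats any power of
    the logarithm. *)
Lemma power_rate q : q < - r ->
  n%:R `^ (- (2 * r)) <= (1 - 2 * (q + r)) `^ (1 - 2 * (q + r)) *
    (n%:R `^ (1 - 2 * r) * L `^ (2 * (q + r) - 1)).
Proof.
move=> qr; set e := 1 - 2 * (q + r).
have e0 : 0 < e by move: r0; rewrite /e; lra.
have -> : 2 * (q + r) - 1 = - e by rewrite /e; ring.
have -> : n%:R `^ (- (2 * r)) = n%:R `^ (1 - 2 * r) / n%:R.
  rewrite -[X in _ / X]powRr1 ?(ltW n0)// -powRB ?(gt_eqF n0) ?implybT//.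
  by congr (_ `^ _); ring.
rewrite [leRHS]mulrCA ler_pM2l ?powR_gt0// [L `^ _]powRN ler_pdivlMr ?powR_gt0//.
rewrite [leLHS]mulrC ler_pdivrMr//.
have := ge0_ler_powR (ltW e0) _ _ (ln_le_powR e0 n0).
rewrite !nnegrE (ltW L0) mulr_ge0 ?powR_ge0 ?(ltW e0)// => /(_ isT isT).
by rewrite powRM ?powR_ge0 ?(ltW e0)// -powRrM mulVf ?gt_eqF// powRr1// ltW.
Qed.

End cross_size.

End rates.

Theorem proposition4p3 (R : realType) (d b : nat)
    (hb : (1 <= b)%N) (hbd : (b <= d)%N)
    (phi : nat -> measurableTypeR R -> R)
    (hphi : orthonormal_basis lebesgue_measure (`[0, 1] : set R) phi)
    (hphi0 : forall u : R, 0 <= u <= 1 -> phi 0%N u = 1)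
    (lambda : nat -> R) (mu r q : R)
    (hlambda : forall i, 0 <= lambda i)
    (hmu : 0 < mu) (hr : 1 / 2 < r) (hq : q < - r)
    (hasym : lambda ~_\oo (fun i : nat => mu * i%:R `^ (- r) * (ln i%:R) `^ q))
    (dT : measure_display) (T : measurableType dT) (P : probability T R)
    (xi : field_index d b -> {RV P >-> R})
    (hmean : forall i, ('E_P[xi i] = 0)%E)
    (hvar : forall i, ('V_P[xi i] = 1)%E)
    (huncor : forall i j, i <> j -> covariance P (xi i) (xi j) = 0%E)
    (X : d.-tuple (measurableTypeR R) -> T -> R)
    (hXmeas : measurable_fun ([set: T] `*` @unit_cube R d)
                (fun wt : T * d.-tuple (measurableTypeR R) => X wt.2 wt.1))
    (hX : forall t, unit_cube t -> mean_square_series P lambda phi xi t (X t)) :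
  exists (C : R) (A : forall n : nat, sampling_algorithm R d n),
    forall n : nat, (2 <= n)%N ->
      (\int[P]_w sqnorm2 (lebesgue_tuple d) (@unit_cube R d)
                   (fun t => (X t w - run_algorithm (A n) (X ^~ w) t)%R)
       <= (C * n%:R `^ (1 - 2 * r) * (ln n%:R) `^ (2 * (q + r) - 1))%:E)%E.
Proof.
have d0 : (0 < d)%N by exact: leq_trans hb hbd.
have r0 : 0 < r by lra.
have p1 : 1 < 2 * r by lra.
have q0 : q < 0 by lra.
pose s := - q / r.
have s1 : 1 < s by rewrite /s ltr_pdivlMr// mul1r; lra.
have sr : s * (2 * r) = - (2 * q) by rewrite /s; field; rewrite gt_eqF.
have [C0 C00 lC0] := asymptotic_weight hlambda hmu r0 q0 hasym.
have [c c0 cardc] := @card_cross_le R d s s1.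
have [Ct Ct0 tailC] := @sum_outside_cross R d s (2 * r) d0 s1 p1.
have [S S0 totalS] := @sum_weight_prod R d s (2 * r) s1 p1.
pose c1 := c + 1.
have c1_ge1 : 1 <= c1 by rewrite lerDr ltW.
have c1_gt0 : 0 < c1 by rewrite (lt_le_trans _ c1_ge1).
pose M n := cross_size r c1 n.
have M1 n : 1 <= M n.
  have cr0 : 0 <= 2 * r * c1 by rewrite mulr_ge0 ?mulr_ge0// ltW.
  rewrite lerDl mulr_ge0// invr_ge0 mulr_ge0//.
  by have [->|n0] := posnP n; [rewrite ln0|rewrite ln_ge0// ler1n].
have M0 n : 0 < M n by rewrite (lt_le_trans _ (M1 n)).
pose K : R := #|{: bsubset d b}|.+1%:R * C0 ^+ (b + b).
have K0 : 0 < K by rewrite mulr_gt0// exprn_gt0.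
pose tail n := Ct * (M n) `^ (1 - 2 * r) * (1 + ln (M n)) `^ (2 * q).
have alg n : exists A : sampling_algorithm R d n,
   (\int[P]_w sqnorm2 (lebesgue_tuple d) (@unit_cube R d)
       (fun t => (X t w - run_algorithm A (X ^~ w) t)%R)
    <= (16 * (K * tail n) + 2 * ((1 - (c1 * M n)^-1) ^+ n * (K * S)))%:E)%E.
  apply: (@field_algorithm R d b phi hphi hphi0 lambda hlambda dT T P xi hmean
    hvar huncor X hXmeas hX s r C0 (M n)) => //.
  - rewrite /tail !mulr_gt0 ?powR_gt0// ltr_pwDl// ln_ge0//.
  - by rewrite mulr_gt0.
  - by move=> B; apply: le_trans (tailC (M n) B (M1 n)) _; rewrite sr opprK.
  - move=> B. apply: le_trans (cardc (M n) B (ltW (M0 n))) _.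
    by rewrite ler_pM2r// lerDl.
pose c' := 2 * r * c1.
pose C1 := c' `^ (2 * r - 1) * (2 * (1 + ln (2 * c')))^-1 `^ (2 * q).
pose C2 := (1 - 2 * (q + r)) `^ (1 - 2 * (q + r)).
exists (16 * (K * (Ct * C1)) + 2 * (expR (8 * r * c') * C2 * (K * S))).
exists (fun n => projT1 (cid (alg n))) => n n2.
apply: le_trans (projT2 (cid (alg n))) _; rewrite lee_fin.
set rate := n%:R `^ (1 - 2 * r) * ln n%:R `^ (2 * (q + r) - 1).
have h1 : tail n <= Ct * (C1 * rate).
  by rewrite /tail -mulrA ler_pM2l//; exact: tail_rate.
have h2 : (1 - (c1 * M n)^-1) ^+ n <= expR (8 * r * c') * (C2 * rate).
  apply: le_trans (@exp_decay _ r c1 n hr c1_ge1 n2) _.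
  by rewrite ler_pM2l ?expR_gt0//; exact: power_rate.
rewrite -[leRHS]mulrA -/rate [leRHS]mulrDl lerD//.
  rewrite [leRHS](_ : _ = 16 * (K * (Ct * (C1 * rate)))); last by ring.
  by rewrite ler_pM2l// ler_pM2l.
rewrite [leRHS](_ : _ = 2 * (expR (8 * r * c') * (C2 * rate) * (K * S))); last by ring.
by rewrite ler_pM2l// ler_pM2r// mulr_gt0.
Qed.
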